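(* Assume that there is $\bar\mu\ge1$ with $\mu_h\le\bar\mu$ for all $h$, and that conditions (Q1)--(Q4) of the context hold with some $\delta>0$. Then the quasi-best-approximation constant $\nu_h$ of the variational discretization satisfies $$\nu_h=\mu_h\big(1+\bar\kappa\,O(h^\delta)\big)\quad\text{as }h\to0,$$ where $$\bar\kappa=\frac{1+2L}{1+L}\left(1+M\left(1+\frac{2M}{\sqrt{\alpha}}\right)\bar\mu\right),\qquad L=\frac{M}{\sqrt{\alpha}},$$ and the constant hidden in $O(h^\delta)$ is independent of $h$ and $\alpha$.
   Context: Let $Q, W, V_1, V_2$ be real Hilbert spaces with norms $\|\cdot\|_Q,\|\cdot\|_W,\|\cdot\|_1,\|\cdot\|_2$; $\langle\cdot,\cdot\rangle_i$ denotes the duality pairing of $V_i^*$ and $V_i$. Let $a:V_1\times V_2\to\mathbb{R}$ be a bounded bilinear form such that, for all $v_1\in V_1$, if $a(v_1,v_2)=0$ for all $v_2\in V_2$, then $v_1=0$, and $\inf_{\|v_2\|_2=1}\sup_{\|v_1\|_1=1}a(v_1,v_2)>0$. The norm of $V_2$ is (after replacing it, if necessary, by an equivalent one) $\|v_2\|_2=\sup_{\varphi_1\in V_1,\ \|\varphi_1\|_1=1}a(\varphi_1,v_2)$, so that the continuity and inf-sup constants of $a$ are both $1$. Let $A:V_1\to V_2^*$, $Av_1=a(v_1,\cdot)$, and $A^*:V_2\to V_1^*$, $A^*v_2=a(\cdot,v_2)$; both are boundedly invertible, and $A^{-*}:=(A^* )^{-1}$. Let $C:Q\to V_2^*$ and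 $I:V_1\to W$ be bounded linear operators with operator norms $M_C$ and $M_I$, $C^*:V_2\to Q$ given by $(q,C^*v_2)_Q=\langle Cq,v_2\rangle_2$, and $M:=\max\{M_I,M_C\}$. Let $\alpha>0$. Set $V:=V_1\times V_2$ with $\|v\|:=(\|v_1\|_1^2+\|v_2\|_2^2)^{1/2}$ and $$b(v,\varphi) := a(v_1,\varphi_2)+a(\varphi_1,v_2)+\tfrac{1}{\sqrt{\alpha}}\big[(C^*v_2,C^*\varphi_2)_Q-(Iv_1,I\varphi_1)_W\big],\quad v,\varphi\in V.$$ Let $h$ range over a sequence of positive numbers tending to $0$. For each $h$, let $V_{h,i}\subset V_i$, $i=1,2$, be finite-dimensional subspaces (not depending on $\alpha$) such that the restriction of $a$ to $V_{h,1}\times V_{h,2}$ is nondegenerate (no nonzero element of either space is annihilated by the whole other space), and $V_h:=V_{h,1}\times V_{h,2}$. The generalized Ritz projection $R_{h,1}:V_1\to V_{h,1}$ is given by $a(R_{h,1}v_1,\varphi_{h,2})=a(v_1,\varphi_{h,2})$ for all $\varphi_{h,2}\in V_{h,2}$. The quasi-best-approximation constant $\mu_h$ of the constraint discretization is the smallest number $\mu_h\ge1$ such that $\|v_1-R_{h,1}v_1\|_1\le\mu_h\inf_{v_{h,1}\in V_{h,1}}\|v_1-v_{h,1}\|_1$ for all $v_1\in V_1$. The quasi-best-approximation constant $\nu_h$ of the variational discretization is the smallest number $\nu_h\ge1$ such that $\|v-G_hv\|\le\nu_h\inf_{v_h\in V_h}\|v-v_h\|$ for all $v\in V$, where $G_hv\in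 V_h$ is the (unique) Galerkin approximation given by $b(G_hv,\varphi_h)=b(v,\varphi_h)$ for all $\varphi_h\in V_h$. Sobolev spaces: fix a domain; for $s\ge0$ let $H^s$ be the Sobolev space over it with norm $\|\cdot\|_{H^s}$, and for $s<0$ let $H^s$ be the dual of $H^{-s}$ with the dual norm. With $L^2=H^0$ as pivot space, $H^t\subset H^s$ for $t\ge s$, and $H^{-s}$ is identified with the dual of $H^s$ for every real $s$; elements of $H^{-s_i}$ act on a subspace $V_i\subset H^{s_i}$ by restriction. (Q1) There are $s_1,s_2\in\mathbb{R}$ and $C_S\ge1$ such that, for $i=1,2$, $V_i$ is a closed subspace of $H^{s_i}$ and $C_S^{-1}\|\cdot\|_{H^{s_i}}\le\|\cdot\|_i\le C_S\|\cdot\|_{H^{s_i}}$ on $V_i$. (Q2) $C\in L(Q,H^{-s_2+\delta})$ and $I\in L(H^{s_1-\delta},W)$, i.e. $C$ maps boundedly into $H^{-s_2+\delta}$ and $I$ extends to a bounded operator on $H^{s_1-\delta}$. (Q3) There is $C_R>0$ such that $\|A^{-1}f\|_{H^{s_1+\delta}}\le C_R\|f\|_{H^{-s_2+\delta}}$ for all $f\in H^{-s_2+\delta}$ and $\|A^{-*}g\|_{H^{s_2+\delta}}\le C_R\|g\|_{H^{-s_1+\delta}}$ for all $g\in H^{-s_1+\delta}$. (Q4) There is $C_{\mathcal I}>0$ such that, for all $h$ and all $v=(v_1,v_2)\in V$ with $v_i\in H^{s_i+\delta}$, $\inf_{v_h\in V_h}\|v-v_h\|\le C_{\mathcal I}h^\delta\big(\|v_1\|_{H^{s_1+\delta}}^2+\|v_2\|_{H^{s_2+\delta}}^2\big)^{1/2}$.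 *)

(* Defs.v *)
From HB Require Import structures.
From mathcomp Require Import all_boot all_order all_algebra sesquilinear.
From mathcomp Require Import all_classical all_reals all_analysis.

Set Implicit Arguments.
Unset Strict Implicit.
Unset Printing Implicit Defensive.

Import Order.TTheory GRing.Theory Num.Theory.
Import numFieldNormedType.Exports.

Local Open Scope classical_set_scope.
Local Open Scope ring_scope.

Notation Rn R n := (n.-tuple (measurableTypeR R)).

Section lebesgue_cons.
Context (R : realType) (n : nat).
Variable mu : {sigma_finite_measure set (Rn R n) -> \bar R}.

Definition tcons (p : measurableTypeR R * Rn R n) : Rn R n.+1 :=
  [the n.+1.-tuple (measurableTypeR R) of p.1 :: p.2].

Definition tuncons (t : Rn R n.+1) : measurableTypeR R * Rn R n :=
  (tnth t ord0, [tuple of behead t]).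

Lemma measurable_tcons : measurable_fun setT tcons.
Proof. exact: measurable_cons. Qed.

Lemma measurable_tuncons : measurable_fun setT tuncons.
Proof.
apply/measurable_fun_pairP; split.
  exact: measurable_tnth.
exact: measurable_behead.
Qed.

Lemma tconsK : cancel tcons tuncons.
Proof.
move=> [x t]; rewrite /tuncons /tcons /=; congr pair.
exact: val_inj.
Qed.

Definition lebesgue_cons : set (Rn R n.+1) -> \bar R :=
  pushforward (lebesgue_measure \x mu)%E tcons.

Let lebesgue_cons0 : lebesgue_cons set0 = 0%E.
Proof. by rewrite /lebesgue_cons /pushforward preimage_set0 measure0. Qed.

Let lebesgue_cons_ge0 A : (0 <= lebesgue_cons A)%E.
Proof. by rewrite /lebesgue_cons /pushforward; exact: measure_ge0. Qed.

Let lebesgue_cons_sigma_additive : semi_sigma_additive lebesgue_cons.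
Proof.
move=> F mF tF mUF; rewrite /lebesgue_cons /pushforward preimage_bigcup.
apply: measure_semi_sigma_additive.
- by move=> k; rewrite -[X in measurable X]setTI; exact: measurable_tcons.
- apply/trivIsetP => /= i j _ _ ij; rewrite -preimage_setI.
  by move/trivIsetP : tF => /(_ _ _ _ _ ij) ->//; rewrite preimage_set0.
- rewrite -preimage_bigcup -[X in measurable X]setTI.
  exact: measurable_tcons.
Qed.

HB.instance Definition _ := isMeasure.Build _ _ _ lebesgue_cons
  lebesgue_cons0 lebesgue_cons_ge0 lebesgue_cons_sigma_additive.

Let lebesgue_cons_sigma_finite : sigma_finite setT lebesgue_cons.
Proof.
have /sigma_finiteP[F [FT ndF Foo]] := sigma_finiteT (@lebesgue_measure R).
have /sigma_finiteP[G [GT ndG Goo]] := sigma_finiteT mu.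
exists (fun k => tuncons @^-1` (F k `*` G k)).
  rewrite -preimage_bigcup (_ : \bigcup_k (F k `*` G k) = setT) ?preimage_setT//.
  rewrite -setXTT FT GT predeqE => -[x y]; split.
    by move=> [k _ []/= ? ?]; split; exists k.
  move=> [/= [k _ Fkx] [l _ Gly]]; exists (maxn k l) => //; split.
  - by move: x Fkx; exact/subsetPset/ndF/leq_maxl.
  - by move: y Gly; exact/subsetPset/ndG/leq_maxr.
move=> k; have [mF Fk] := Foo k; have [mG Gk] := Goo k; split.
  rewrite -[X in measurable X]setTI; apply: measurable_tuncons => //.
  exact: measurableX.
rewrite /lebesgue_cons /pushforward -comp_preimage.
rewrite (_ : tuncons \o tcons = id); last by apply/funext => p /=; rewrite tconsK.
rewrite preimage_id.
by rewrite product_measure1E// lte_mul_pinfty// ge0_fin_numE.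
Qed.

HB.instance Definition _ := Measure_isSigmaFinite.Build _ _ _ lebesgue_cons
  lebesgue_cons_sigma_finite.

End lebesgue_cons.

(* Lebesgue measure on Borel sets of R^n, as an iterated product measure *)
Fixpoint lebesgue_Rn (R : realType) (n : nat) :
    {sigma_finite_measure set (Rn R n) -> \bar R} :=
  match n with
  | 0 => dirac ([tuple] : Rn R 0)
  | m.+1 => lebesgue_cons (lebesgue_Rn R m)
  end.

(* Sobolev-Slobodeckij spaces on a domain Omega of R^d.  Points are row        *)
(* vectors for the topology and tuples for integration; rvec is the           *)
(* identification of the two.                                                 *)
Section sobolev.
Context (R : realType) (d : nat) (Omega : set 'rV[R]_d).

Definition is_domain := [/\ open Omega, connected Omega & Omega !=set0].

Definition rvec (x : Rn R d) : 'rV[R]_d := \row_i (tnth x i : R).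

Definition edist (x y : Rn R d) : R :=
  Num.sqrt (\sum_(i < d) ((tnth x i : R) - (tnth y i : R)) ^+ 2).

Local Notation D := (rvec @^-1` Omega).
Local Notation leb := (lebesgue_Rn R d).
Local Notation fn := (Rn R d -> R).

Definition pderiv (s : seq 'I_d) (f : 'rV[R]_d -> R) : 'rV[R]_d -> R :=
  foldr (fun i g x => 'D_(delta_mx 0 i) g x) f s.

Definition test_function (phi : 'rV[R]_d -> R) :=
  (forall s, continuous (pderiv s phi) /\
     forall i x, derivable (pderiv s phi) x (delta_mx 0 i)) /\
  exists2 K, compact K /\ K `<=` Omega & forall x, ~ K x -> phi x = 0.

Definition mdeg k (b : {ffun 'I_d -> 'I_k.+1}) : nat := (\sum_i b i)%N.

Definition mderiv k (b : {ffun 'I_d -> 'I_k.+1}) :=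
  pderiv (flatten [seq nseq (b i) i | i <- enum 'I_d]).

Definition weak_deriv k (b : {ffun 'I_d -> 'I_k.+1}) (u w : fn) :=
  forall phi, test_function phi ->
    \int[leb]_(x in D) (u x * mderiv b phi (rvec x)) =
    (-1) ^+ mdeg b * \int[leb]_(x in D) (w x * phi (rvec x)).

(* For s = k + sigma with k integer and 0 <= sigma < 1, a jet of u is a       *)
(* family of weak derivatives of u of all orders at most k.                   *)
Definition multi_index (s : R) := {ffun 'I_d -> 'I_(Num.truncn s).+1}.

Definition jet (s : R) (u : fn) (w : multi_index s -> fn) :=
  w [ffun=> ord0] = u /\
  forall b, (mdeg b <= Num.truncn s)%N ->
    measurable_fun D (w b) /\ weak_deriv b u (w b).

Definition slobodeckij (sigma : R) (w : fn) : \bar R :=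
  \int[(leb \x leb)%E]_(z in D `*` D)
    ((w z.1 - w z.2) ^+ 2 / edist z.1 z.2 `^ (d%:R + sigma *+ 2))%:E.

Definition jet_energy (s : R) (w : multi_index s -> fn) : \bar R :=
  let k := Num.truncn s in let sigma := s - k%:R in
  (\sum_(b | (mdeg b <= k)%N) \int[leb]_(x in D) (w b x ^+ 2)%:E +
   if sigma == 0%R then 0
   else \sum_(b | mdeg b == k) slobodeckij sigma (w b))%E.

(* Weak derivatives are determined a.e. only, and all jets of u have the same *)
(* energy; the infimum is over that one value, or over the empty set.         *)
Definition sobolev_energy (s : R) (u : fn) : \bar R :=
  ereal_inf [set jet_energy w | w in jet (s := s) u].

Definition HF (s : R) : set fn := [set u | (sobolev_energy s u < +oo)%E].

Definition HF_norm (s : R) (u : fn) : R := Num.sqrt (fine (sobolev_energy s u)).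

(* This fails for the intrinsic norms on some irregular domains, so it has to *)
(* be assumed; it holds on Lipschitz domains.                                 *)
Definition sobolev_nested := forall s t, 0 <= s -> s <= t ->
  HF t `<=` HF s /\
  exists K, forall u, HF t u -> HF_norm s u <= K * HF_norm t u.

(* The scale H^s, s real.  An element of H^s is represented by a functional   *)
(* on functions: for s < 0 it is an element of the dual of H^(-s); for s >= 0 *)
(* it is phi |-> (u, phi)_{L^2} with u in H^s, L^2 being the pivot space.     *)
(* Two functionals represent the same element of H^s when they agree on       *)
(* H^(max(0, -s)) (see Hs_eq); their other values are irrelevant.  The        *)
(* inclusion of H^t in H^s for t >= s does not change the functional.         *)
Definition pivot (u : fn) : fn -> R :=
  fun phi => \int[leb]_(x in D) (u x * phi x).

Definition Hs_eq (s : R) (f g : fn -> R) :=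
  forall phi, HF (Num.max 0 (- s)) phi -> f phi = g phi.

Definition Hs (s : R) : set (fn -> R) := [set f |
  if 0 <= s then exists2 u, HF s u & Hs_eq s f (pivot u)
  else (forall c u v, HF (- s) u -> HF (- s) v ->
          f (c *: u + v) = c * f u + f v) /\
       exists K, forall u, HF (- s) u -> `|f u| <= K * HF_norm (- s) u].

(* the function represented by an element f of H^s, s >= 0 *)
Definition Hs_fun (s : R) (f : fn -> R) : fn :=
  xget (fun=> 0) [set u | HF s u /\ Hs_eq s f (pivot u)].

Definition Hs_norm (s : R) (f : fn -> R) : R :=
  if 0 <= s then HF_norm s (Hs_fun s f)
  else sup [set `|f u| | u in [set u | HF (- s) u /\ HF_norm (- s) u <= 1]].

(* duality pairing of g in H^(-s) and f in H^s *)
Definition Hs_pair (s : R) (g f : fn -> R) : R :=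
  if 0 <= s then g (Hs_fun s f) else f (Hs_fun (- s) g).

(* membership in H^t, t >= s, of an element f of H^s, and its norm there *)
Definition Hs_in (s t : R) (f : fn -> R) := exists2 g, Hs t g & Hs_eq s f g.

Definition Hs_norm_in (s t : R) (f : fn -> R) : R :=
  inf [set Hs_norm t g | g in [set g | Hs t g /\ Hs_eq s f g]].

(* J realizes V as a closed subspace of H^s with equivalent norm. *)
Definition closed_subspace_of (s : R) (V : normedModType R)
    (J : V -> fn -> R) (CS : R) :=
  [/\ forall v, Hs s (J v),
      forall v_ f, Hs s f ->
        Hs_norm s (J (v_ n) - f) @[n --> \oo] --> (0 : R) ->
        exists v, Hs_eq s (J v) f &
      forall v, CS^-1 * Hs_norm s (J v) <= `|v| <= CS * Hs_norm s (J v)].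

(* the functional on V induced by g in H^(-s) *)
Definition restr (s : R) (V : Type) (J : V -> fn -> R) (g : fn -> R) : V -> R :=
  fun v => Hs_pair s g (J v).

End sobolev.

Section hilbert.
Context (R : realType).

Definition hilbert_norm (V : normedModType R) (ip : {dot V for idfun}) :=
  forall v : V, `|v| ^+ 2 = ip v v.

Definition bounded_form (U V : normedModType R) (B : U -> V -> R) :=
  exists K, forall u v, `|B u v| <= K * `|u| * `|v|.

Definition bounded_op (U V : normedModType R) (T : U -> V) :=
  exists K, forall u, `|T u| <= K * `|u|.

Definition op_norm (U V : normedModType R) (T : U -> V) : R :=
  sup [set `|T u| | u in [set u | `|u| <= 1]].

Definition dual_norm (V : normedModType R) (f : V -> R) : R :=
  sup [set `|f v| | v in [set v | `|v| <= 1]].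

(* norm of u |-> B u (-) as an operator from U to the dual of V *)
Definition form_norm (U V : normedModType R) (B : U -> V -> R) : R :=
  sup [set dual_norm (B u) | u in [set u | `|u| <= 1]].

Definition inv_op (U : zmodType) (F : Type) (T : U -> F) (f : F) : U :=
  xget 0 [set u | T u = f].

Definition fin_dim_subspace (V : lmodType R) (S : set V) :=
  exists n (e : 'I_n -> V),
    S = [set \sum_(i < n) c i *: e i | c in [set: 'I_n -> R]].

Definition nondegenerate_on (U V : zmodType) (B : U -> V -> R)
    (S : set U) (T : set V) :=
  (forall u, S u -> (forall v, T v -> B u v = 0) -> u = 0) /\
  (forall v, T v -> (forall u, S u -> B u v = 0) -> v = 0).

(* Petrov-Galerkin projection: trial space S, test space T *)
Definition galerkin (U V : zmodType) (B : U -> V -> R) (S : set U) (T : set V)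
    (u : U) : U :=
  xget 0 [set g | S g /\ forall t, T t -> B g t = B u t].

Definition best_error (U : zmodType) (nrm : U -> R) (S : set U) (u : U) : R :=
  inf [set nrm (u - w) | w in S].

Definition quasi_best_const (U : zmodType) (nrm : U -> R) (S : set U)
    (P : U -> U) : R :=
  inf [set m | 1 <= m /\ forall u, nrm (u - P u) <= m * best_error nrm S u].

(* Euclidean combination; the library norm on a product is the maximum norm *)
Definition pair_norm (U V : normedModType R) (v : U * V) : R :=
  Num.sqrt (`|v.1| ^+ 2 + `|v.2| ^+ 2).

Definition var_form (Q W V1 V2 : Type) (a : V1 -> V2 -> R) (Cs : V2 -> Q)
    (I : V1 -> W) (ipQ : Q -> Q -> R) (ipW : W -> W -> R) (alpha : R)
    (v phi : V1 * V2) : R :=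
  a v.1 phi.2 + a phi.1 v.2 +
  (Num.sqrt alpha)^-1 * (ipQ (Cs v.2) (Cs phi.2) - ipW (I v.1) (I phi.1)).

Definition kappa_bar (M mubar alpha : R) : R :=
  let L := M / Num.sqrt alpha in
  (1 + 2 * L) / (1 + L) * (1 + M * (1 + 2 * M / Num.sqrt alpha) * mubar).

End hilbert.

(* Main.v *)
Require Import Defs.
From HB Require Import structures.
From mathcomp Require Import all_boot all_order all_algebra sesquilinear.
From mathcomp Require Import all_classical all_reals all_analysis.
From mathcomp Require Import measurable_realfun.
From mathcomp Require Import ring lra.

Set Implicit Arguments.
Unset Strict Implicit.
Unset Printing Implicit Defensive.

Import Order.TTheory GRing.Theory Num.Theory.
Import numFieldNormedType.Exports.

Local Open Scope classical_set_scope.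
Local Open Scope ring_scope.

(* Write the error of the variational discretization as e = rho + theta, where
   rho = v - R_h v is the error of the pair R_h of Ritz projections and theta
   lies in V_h.  Since a(x, v2 - R_{h,2} v2) = a(x - R_{h,1} x, v2 - w2), both
   components of R_h have the constant mu_h, so ||rho|| <= mu_h inf ||v - v_h||.
   Testing Galerkin orthogonality with (-theta_1, theta_2) cancels a and gives
   |(C^* e_2, I e_1)| <= |(C^* rho_2, I rho_1)| without any dependence on alpha;
   testing with discrete inf-sup partners of theta then gives
   ||theta|| <= (1 + mu_h) M alpha^(-1/2) |(C^* rho_2, I rho_1)|.  By duality for
   a alone (Aubin-Nitsche), the last factor is at most c h^delta ||rho||.  Hence
   ||e|| and ||rho|| agree up to a factor 1 +- c alpha^(-1/2) h^delta, for all h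
   and alpha, and M^2 alpha^(-1/2) is dominated by kappa_bar.                  *)

(** No inf-sup constant of b is used, as it could bring in alpha; alpha^(-1/2) enters the error
    estimate only when theta is bounded. The rest concerns [a] alone. The prescribed norm of [V2]
    makes v2 |-> a(-, v2) an isometry onto the dual of [V1], so every vector has an exact partner of
    equal norm. The Ritz projection of a partner keeps its pairing with discrete vectors and costs
    at most a factor 1 + mu_h: this is the discrete inf-sup condition and the origin of 1 + mu_h in
    the bound on theta. The lower bound for nu_h comes from pairs (v1, 0), whose best error is at
    most that of v1 in V_{h,1}. The duality step is not symmetric in C and I: C already maps into
    the data space of the regularity estimate, whereas the extension of I has to be converted into
    data for the adjoint problem, in a way that depends on the sign of s1 - delta. Elements of the
    scale are functionals meaningful only on a suitable class of functions, so independence of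
    representatives needs proof. *)

Lemma sup_ge0 (R : realType) (S : set R) : (forall x, S x -> 0 <= x) -> 0 <= sup S.
Proof.
move=> S0; have [supS|/sup_out->//] := pselect (has_sup S).
have [[x Sx] _] := supS; exact: le_trans (S0 x Sx) (ub_le_sup supS.2 Sx).
Qed.

Lemma inf_ge0 (R : realType) (S : set R) : (forall x, S x -> 0 <= x) -> 0 <= inf S.
Proof.
move=> S0; have [->|/set0P S_neq0] := eqVneq S set0; first by rewrite inf0.
exact: lb_le_inf.
Qed.

(** * Measurability and square integrability *)

Section rvec_measurability.
Context (R : realType) (d : nat).
(** The sigma-algebra on tuples is generated by the coordinates, while [O] is open for the norm of
    row vectors. A countable base links the two: [O] is the union of the cubes [B p] it contains,
    with rational centre and radius 1/(n+1), and each cube is a finite intersection of coordinate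
    preimages. *)
Lemma measurable_preimage_rvec (O : set 'rV[R]_d) :
  open O -> measurable (@rvec R d @^-1` O).
Proof.
move=> oO.
pose B (p : 'rV[rat]_d * nat) : set 'rV[R]_d :=
  [set x | forall j, `|ratr (p.1 0 j) - x 0 j| < p.2.+1%:R^-1].
have -> : rvec (R:=R) (d:=d) @^-1` O =
    \bigcup_(p in setT) (if `[< B p `<=` O >] then (@rvec R d) @^-1` B p else set0).
  apply/seteqP; split => [x /= Ox|x [p _]]; last by case: asboolP => // BO /BO.
  move: oO; rewrite openE => /(_ _ Ox) /nbhs_ballP [e e0 eO].
  (* Half of [e], because x is not the centre: points of the cube are within 2/(n+1) of x. *)
  have [n ne] : exists n, n.+1%:R^-1 < e / 2.
    have e2 : 0 < e / 2 by exact: divr_gt0.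
    by near \oo => n; exists n; near: n; exact: (near_infty_natSinv_lt (PosNum e2)).
  have q j : {q : rat | `|ratr q - rvec x 0 j| < n.+1%:R^-1}.
    apply: cid; have /rat_in_itvoo [q] :
      rvec x 0 j - n.+1%:R^-1 < rvec x 0 j + n.+1%:R^-1.
      by rewrite ltrD2l (@lt_trans _ _ 0) ?oppr_lt0.
    by rewrite in_itv /= => /andP[q1 q2]; exists q; rewrite ltr_distl q1 q2.
  exists (\row_j sval (q j), n) => //.
  case: asboolP => [_ j|]; first by rewrite /= mxE; case: (q j).
  case=> y By; apply: eO; rewrite /ball /=; split => // i j.
  rewrite (ord1 i); move: (By j) => /=; rewrite mxE; case: (q j) => r /= rx ry.
  rewrite /ball /= -(subrKA (ratr r)).
  by rewrite (le_lt_trans (ler_normD _ _)) // distrC (splitr e) ltrD // (lt_trans _ ne).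
apply: countable_bigcupT_measurable => [|p]; first exact: countableP.
case: asboolP => // _.
rewrite (_ : _ @^-1` _ = \bigcap_(j in setT)
  ((fun t : Rn R d => tnth t j) @^-1` ball (ratr (p.1 0 j) : R) p.2.+1%:R^-1)).
  apply: fin_bigcap_measurable => // j _.
  rewrite -[X in measurable X]setTI; apply: measurable_tnth => //.
  exact: measurable_ball.
by apply/seteqP; split => x /= H j; [move=> _|]; move: (H j); rewrite /= /ball /= mxE // => /(_ I).
Unshelve. all: by end_near. Qed.

Lemma measurable_fun_rvec (f : 'rV[R]_d -> R) :
  continuous f -> measurable_fun setT (f \o @rvec R d).
Proof.
move=> /continuousP cf; apply: (measurability _ (RGenOpens.measurableE R)).
move=> _ [_ [a [b ->]] <-]; rewrite setTI comp_preimage.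
by apply: measurable_preimage_rvec; apply: cf; exact: interval_open.
Qed.

Lemma measurable_edist :
  measurable_fun setT (fun z : Rn R d * Rn R d => Defs.edist z.1 z.2).
Proof.
rewrite /Defs.edist; apply: measurableT_comp => /=.
  by apply: continuous_measurable_fun => x; exact: sqrt_continuous.
apply: measurable_sum => i; apply: measurable_funX; apply: measurable_funB.
  exact: (measurableT_comp (measurable_tnth i) measurable_fst).
exact: (measurableT_comp (measurable_tnth i) measurable_snd).
Qed.

End rvec_measurability.

Section square_integrable.
Context d (T : measurableType d) (R : realType).
Variables (mu : {measure set T -> \bar R}) (D : set T).
Hypothesis mD : measurable D.

(** [Rintegral] applies [fine], which sends infinite values to 0, and the extended integral of a
    measurable non-integrable function is never finite: oo - oo also evaluates to an infinite
    value. *)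
Lemma Rintegral_nonintegrable (f : T -> R) :
  measurable_fun D f -> ~ mu.-integrable D (EFin \o f) ->
  \int[mu]_(x in D) f x = 0.
Proof.
move=> mf nif; rewrite /Rintegral.
have [fin|] := boolP (\int[mu]_(x in D) (f x)%:E \is a fin_num)%E; last first.
  by rewrite fin_numEn => /orP[] /eqP ->.
exfalso; apply: nif; apply/integrableP; split; first exact/measurable_EFinP.
by rewrite integral_fin_num_abs.
Qed.

(** Without integrability both sides are 0. [jet_scale] relies on this case: the entries of a jet
    are only known to be measurable, so their products with test functions may fail to be
    integrable. *)
Lemma Rintegral_scale (f : T -> R) c : measurable_fun D f ->
  \int[mu]_(x in D) (c * f x) = c * \int[mu]_(x in D) f x.
Proof.
move=> mf; have [If|nIf] := pselect (mu.-integrable D (EFin \o f)).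
  exact: RintegralZl.
rewrite (Rintegral_nonintegrable mf nIf) mulr0.
have [->|c0] := eqVneq c 0.
  by under eq_Rintegral do rewrite mul0r; rewrite Rintegral_cst ?mul0r.
apply: Rintegral_nonintegrable; first exact: measurable_funM.
move=> Icf; apply: nIf.
rewrite (_ : EFin \o f = (fun x => c^-1%:E * (EFin \o (fun x => (c * f x)%R)) x)%E).
  exact: integrableZl.
by apply/funext => x /=; rewrite -EFinM mulKf.
Qed.

Definition square_integrable (f : T -> R) :=
  measurable_fun D f /\ (\int[mu]_(x in D) (f x ^+ 2)%:E < +oo)%E.

Lemma square_integrableP (f : T -> R) : square_integrable f <->
  measurable_fun D f /\ mu.-integrable D (EFin \o (fun x => f x ^+ 2)).
Proof.
have E : (\int[mu]_(x in D) `|(EFin \o (fun x => (f x ^+ 2)%R)) x| =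
    \int[mu]_(x in D) (f x ^+ 2)%:E)%E.
  by apply: eq_integral => x _; rewrite gee0_abs ?lee_fin ?sqr_ge0.
split=> -[mf ff]; split => //; last by case/integrableP: ff => _; rewrite E.
by apply/integrableP; split; [apply/measurable_EFinP; exact: measurable_funX|rewrite E].
Qed.

Lemma integrable_sqr_mul (f g : T -> R) :
  square_integrable f -> square_integrable g ->
  mu.-integrable D (EFin \o (fun x => f x * g x)).
Proof.
move=> /square_integrableP[mf If] /square_integrableP[mg Ig].
apply: (le_integrable mD _ _ (integrableD mD If Ig)).
  by apply/measurable_EFinP; exact: measurable_funM.
move=> x _ /=; rewrite lee_fin [leRHS]ger0_norm ?addr_ge0 ?sqr_ge0//.
by rewrite ler_norml; apply/andP; split; nra.
Qed.

Lemma square_integrable_lin c (f g : T -> R) :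
  square_integrable f -> square_integrable g ->
  square_integrable (c *: f + g).
Proof.
move=> Lf Lg; have If := integrable_sqr_mul Lf Lf.
have Ig := integrable_sqr_mul Lg Lg; case: Lf => mf _; case: Lg => mg _.
apply/square_integrableP; split.
  by apply: measurable_funD => //; exact: measurable_funM.
apply: (le_integrable mD _ _
  (integrableD mD (integrableZl mD (2 * c ^+ 2) If) (integrableZl mD 2 Ig))).
  apply/measurable_EFinP/measurable_funX.
  by apply: measurable_funD => //; exact: measurable_funM.
move=> x _ /=; rewrite lee_fin.
rewrite (_ : (c *: f + g) x = c * f x + g x) //.
rewrite [leLHS]ger0_norm ?sqr_ge0// (le_trans _ (ler_norm _))//.
have := sqr_ge0 (c * f x - g x); nra.
Qed.

Lemma Rintegral_lin_mul c (f g phi : T -> R) : square_integrable f ->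
  square_integrable g -> square_integrable phi ->
  \int[mu]_(x in D) ((c *: f + g) x * phi x) =
  c * \int[mu]_(x in D) (f x * phi x) + \int[mu]_(x in D) (g x * phi x).
Proof.
move=> Lf Lg Lp; have If := integrable_sqr_mul Lf Lp.
have Ig := integrable_sqr_mul Lg Lp.
rewrite -RintegralZl// -RintegralD//; last first.
  exact: (integrableZl mD c If).
by apply: eq_Rintegral => x _; rewrite mulrA -mulrDl.
Qed.

(** The discriminant criterion, behind the Cauchy-Schwarz inequalities for integrals and inner
    products and the residual bound in [riesz]. For C > 0 the minimizer t = - B / C is inserted. *)
Lemma sqr_le_of_quadratic_ge0 (A B C : R) : 0 <= C ->
  (forall t, 0 <= A + t * B *+ 2 + t ^+ 2 * C) -> B ^+ 2 <= A * C.
Proof.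
move=> C0 H; have [C_eq0|C_neq0] := eqVneq C 0.
  have [->|B0] := eqVneq B 0; first by rewrite C_eq0 mulr0 expr0n.
  (* At this t the affine function A + 2 t B equals -1. *)
  have := H (- (A + 1) / (2 * B)).
  rewrite C_eq0 mulr0 addr0 (_ : _ / _ * B *+ 2 = - (A + 1)); last by field.
  lra.
have Cp : 0 < C by rewrite lt_neqAle eq_sym C_neq0.
have := H (- B / C); rewrite (_ : A + _ + _ = (A * C - B ^+ 2) / C); last by field.
by rewrite pmulr_lge0 ?invr_gt0// subr_ge0.
Qed.

Lemma Rintegral_cauchy_schwarz (f g : T -> R) :
  square_integrable f -> square_integrable g ->
  `|\int[mu]_(x in D) (f x * g x)| <=
  Num.sqrt (\int[mu]_(x in D) (f x * f x)) *
  Num.sqrt (\int[mu]_(x in D) (g x * g x)).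
Proof.
move=> Lf Lg.
pose P h k := \int[mu]_(x in D) (h x * k x).
have pos h : 0 <= P h h by apply: Rintegral_ge0 => x _; rewrite -expr2 sqr_ge0.
have sym h k : P h k = P k h by apply: eq_Rintegral => x _; rewrite mulrC.
rewrite -/(P f f) -/(P g g) -/(P f g).
rewrite -sqrtrM// -sqrtr_sqr; apply: ler_wsqrtr.
apply: sqr_le_of_quadratic_ge0 => // t.
have Lh := square_integrable_lin t Lg Lf.
have lin k : square_integrable k -> P (t *: g + f) k = t * P g k + P f k.
  exact: Rintegral_lin_mul.
have := pos (t *: g + f); rewrite lin // sym lin // [P f (_ + _)]sym lin //.
by rewrite (sym g f) (_ : t * _ + _ = P f f + t * P f g *+ 2 + t ^+ 2 * P g g) //; ring.
Qed.

Lemma Rintegral_sqr_eq0 (f : T -> R) : square_integrable f ->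
  \int[mu]_(x in D) (f x * f x) = 0 -> \forall x \ae mu, D x -> f x = 0.
Proof.
move=> /square_integrableP[mf If] f0.
have /ae_eq_integral_abs : measurable_fun D (EFin \o (fun x => f x ^+ 2)).
  by apply/measurable_EFinP; exact: measurable_funX.
move=> /(_ mu mD)[+ _].
have -> : (\int[mu]_(x in D) `|(EFin \o (fun x => (f x ^+ 2)%R)) x| = 0)%E.
  transitivity (\int[mu]_(x in D) (f x * f x))%:E; last by rewrite f0.
  (* Integrability matters here: [fine] would also turn an infinite integral into 0. *)
  rewrite /Rintegral fineK; last exact: (integrable_fin_num mD If).
  by apply: eq_integral => x _; rewrite gee0_abs ?lee_fin ?sqr_ge0.
move=> /(_ erefl); apply: filterS => x H Dx.
by have [] := H Dx => /eqP; rewrite sqrf_eq0 => /eqP.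
Qed.

End square_integrable.

(** * The Sobolev scale *)

Section sobolev_theory.
Context (R : realType) (d : nat) (Omega : set 'rV[R]_d).
Hypothesis oOmega : open Omega.

Local Notation D := (@rvec R d @^-1` Omega).
Local Notation leb := (lebesgue_Rn R d).
Local Notation fn := (Rn R d -> R).

Let mD : measurable D.
Proof. exact: measurable_preimage_rvec. Qed.

Lemma mderiv0 k (phi : 'rV[R]_d -> R) :
  mderiv ([ffun=> ord0] : {ffun 'I_d -> 'I_k.+1}) phi = phi.
Proof.
rewrite /mderiv (_ : flatten _ = [::]) //.
by elim: (enum 'I_d) => //= i s ->; rewrite ffunE.
Qed.

Lemma mdeg0 k : mdeg ([ffun=> ord0] : {ffun 'I_d -> 'I_k.+1}) = 0%N.
Proof. by rewrite /mdeg big1 // => i _; rewrite ffunE. Qed.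

Lemma weak_deriv0 k (u : fn) :
  weak_deriv Omega ([ffun=> ord0] : {ffun 'I_d -> 'I_k.+1}) u u.
Proof. by move=> phi _; rewrite mderiv0 mdeg0 mul1r. Qed.

Lemma integral_sqr_scale (v v' : fn) c :
  measurable_fun D v -> measurable_fun D v' ->
  (\forall x \ae leb, D x -> v' x = c * v x) ->
  (\int[leb]_(x in D) (v' x ^+ 2)%:E =
   (c ^+ 2)%:E * \int[leb]_(x in D) (v x ^+ 2)%:E)%E.
Proof.
move=> mv mv' vv'; rewrite -ge0_integralZl_EFin ?sqr_ge0//; last 2 first.
- by move=> x _; rewrite lee_fin sqr_ge0.
- by apply/measurable_EFinP; exact: measurable_funX.
apply: ge0_ae_eq_integral => //.
- by apply/measurable_EFinP; exact: measurable_funX.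
- apply/measurable_EFinP; apply: measurable_funM => //; exact: measurable_funX.
- by move=> x _; rewrite lee_fin sqr_ge0.
- by move=> x _; rewrite -EFinM lee_fin mulr_ge0 ?sqr_ge0.
- by apply: filterS vv' => x H Dx; rewrite H // exprMn EFinM.
Qed.

(** The exceptional pairs lie in two strips over the null set [N], each null for the product
    measure. This carries almost everywhere relations into the double integral of [slobodeckij]. *)
Lemma ae_prod (P : Rn R d -> Prop) : (\forall x \ae leb, P x) ->
  \forall z \ae (leb \x leb)%E, P z.1 /\ P z.2.
Proof.
move=> [N [mN N0 subN]].
have mNT : measurable (N `*` @setT (Rn R d)) by exact: measurableX.
have mTN : measurable (@setT (Rn R d) `*` N) by exact: measurableX.
exists (N `*` setT `|` setT `*` N); split; first exact: measurableU.
- have N1 : (leb \x leb)%E (N `*` @setT (Rn R d)) = 0%E.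
    by rewrite product_measure1E //; move: N0 => /= ->; rewrite mul0e.
  have N2 : (leb \x leb)%E (@setT (Rn R d) `*` N) = 0%E.
    by rewrite product_measure1E //; move: N0 => /= ->; rewrite mule0.
  exact: (etrans (measureU0 mNT mTN N2)).
- by move=> z /= /not_andP[] nP; [left|right]; split => //; exact: subN.
Qed.

Lemma measurable_slobodeckij sigma (w : fn) : measurable_fun D w ->
  measurable_fun (D `*` D) (fun z : Rn R d * Rn R d =>
    (w z.1 - w z.2) ^+ 2 / Defs.edist z.1 z.2 `^ (d%:R + sigma *+ 2)).
Proof.
move=> mw; apply: measurable_funM.
  apply: measurable_funX; apply: measurable_funB.
    apply: (measurable_comp mD _ mw); first by move=> _ [z [Dz _] <-].
    by apply: measurable_funTS; exact: measurable_fst.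
  apply: (measurable_comp mD _ mw); first by move=> _ [z [_ Dz] <-].
  by apply: measurable_funTS; exact: measurable_snd.
apply: measurable_funTS; under eq_fun do rewrite -powRN.
exact: (measurableT_comp (@measurable_powR R (- (d%:R + sigma *+ 2)))
  (@measurable_edist R d)).
Qed.

Lemma slobodeckij_ge0 sigma (w : fn) : (0 <= slobodeckij Omega sigma w)%E.
Proof.
by apply: integral_ge0 => z _; rewrite lee_fin mulr_ge0 ?sqr_ge0 // invr_ge0 powR_ge0.
Qed.

Lemma slobodeckij_scale sigma (v v' : fn) c :
  measurable_fun D v -> measurable_fun D v' ->
  (\forall x \ae leb, D x -> v' x = c * v x) ->
  slobodeckij Omega sigma v' = ((c ^+ 2)%:E * slobodeckij Omega sigma v)%E.
Proof.
move=> mv mv' vv'; have mDD := measurableX mD mD.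
rewrite /slobodeckij -ge0_integralZl_EFin ?sqr_ge0//; last 2 first.
- by move=> z _; rewrite lee_fin mulr_ge0 ?sqr_ge0 // invr_ge0 powR_ge0.
- by apply/measurable_EFinP; exact: measurable_slobodeckij.
apply: ge0_ae_eq_integral => //.
- by apply/measurable_EFinP; exact: measurable_slobodeckij.
- apply/measurable_EFinP; apply: measurable_funM => //.
  exact: measurable_slobodeckij.
- by move=> z _; rewrite lee_fin mulr_ge0 ?sqr_ge0 // invr_ge0 powR_ge0.
- move=> z _; rewrite -EFinM lee_fin mulr_ge0 ?sqr_ge0 //.
  by rewrite mulr_ge0 ?sqr_ge0 // invr_ge0 powR_ge0.
- apply: filterS (ae_prod vv') => z [H1 H2] [Dz1 Dz2].
  by rewrite H1 // H2 // -mulrBr exprMn -mulrA EFinM.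
Qed.

(** Scaling and change of representative at once: c = 1 gives independence of the representative, c
    = 0 treats null functions, and c = 1/norm normalizes. An almost everywhere relation suffices
    because energies and pairings with test functions are integrals. *)
Lemma jet_scale s (u u' : fn) c (w : multi_index d s -> fn) :
  jet Omega u w -> measurable_fun D u' ->
  (\forall x \ae leb, D x -> u' x = c * u x) ->
  exists2 w' : multi_index d s -> fn, jet Omega u' w' &
    (jet_energy Omega w' = (c ^+ 2)%:E * jet_energy Omega w)%E.
Proof.
move=> [w0 jw] mu' uu'.
(* [jet] asks for an equality of functions at the multi-index 0, so that entry has to be [u'] itself
   rather than c times u. *)
pose w' (b : multi_index d s) : fn :=
  if b == [ffun=> ord0] then u' else (fun x => c * w b x).
have mw' b : (mdeg b <= Num.truncn s)%N -> measurable_fun D (w' b).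
  move=> bs; rewrite /w'; case: eqP => // _.
  by apply: measurable_funM => //; case: (jw b bs).
have ww' b : (mdeg b <= Num.truncn s)%N ->
    \forall x \ae leb, D x -> w' b x = c * w b x.
  move=> bs; rewrite /w'; case: eqP => [->|_]; first by rewrite w0.
  exact: aeW.
have mu : measurable_fun D u.
  by rewrite -w0; case: (jw [ffun=> ord0]) => //; rewrite mdeg0.
exists w'.
  split=> [|b bs]; first by rewrite /w' eqxx.
  split; first exact: mw'.
  rewrite /w'; case: eqP => [->|_]; first exact: weak_deriv0.
  move=> phi tphi; have [mwb /(_ phi tphi) wb] := jw b bs.
  have mphi q : measurable_fun D (fun x => pderiv q phi (rvec x)).
    by apply: measurable_funTS; apply: measurable_fun_rvec; case: tphi => /(_ q)[].
  transitivity (\int[leb]_(x in D) (c * (u x * mderiv b phi (rvec x)))).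
    congr fine; apply: ae_eq_integral => //.
    - by apply/measurable_EFinP; apply: measurable_funM => //; exact: mphi.
    - apply/measurable_EFinP; apply: measurable_funM => //.
      by apply: measurable_funM => //; exact: mphi.
    - by apply: filterS uu' => x H Dx; rewrite H // mulrA.
  rewrite Rintegral_scale //; last by apply: measurable_funM => //; exact: mphi.
  rewrite wb mulrCA -Rintegral_scale //.
    by congr (_ * _); apply: eq_Rintegral => x _; rewrite mulrA.
  by apply: measurable_funM => //; exact: (mphi [::]).
have c2 : 0 <= c ^+ 2 by exact: sqr_ge0.
have sq0 b : (0 <= \int[leb]_(x in D) (w b x ^+ 2)%:E)%E.
  by apply: integral_ge0 => x _; rewrite lee_fin sqr_ge0.
rewrite /jet_energy ge0_muleDr ?sume_ge0//; last first.
  by case: ifP => // _; apply: sume_ge0 => b _; exact: slobodeckij_ge0.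
congr (_ + _)%E.
  rewrite ge0_sume_distrr//; apply: eq_bigr => b bs.
  by apply: integral_sqr_scale; [case: (jw b bs)|exact: mw'|exact: ww'].
case: ifP => _; first by rewrite mule0.
rewrite ge0_sume_distrr; last by move=> b _; exact: slobodeckij_ge0.
apply: eq_bigr => b /eqP bs; have bs' : (mdeg b <= Num.truncn s)%N by rewrite bs.
by apply: slobodeckij_scale; [case: (jw b bs')|exact: mw'|exact: ww'].
Qed.

End sobolev_theory.

Section sobolev_scale.
Context (R : realType) (d : nat) (Omega : set 'rV[R]_d).
Hypotheses (oOmega : open Omega) (nested : sobolev_nested Omega).

Local Notation D := (@rvec R d @^-1` Omega).
Local Notation leb := (lebesgue_Rn R d).
Local Notation fn := (Rn R d -> R).
Local Notation L2 := (square_integrable leb D).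

Let mD : measurable D.
Proof. exact: measurable_preimage_rvec. Qed.

Lemma jet_measurable s (u : fn) (w : multi_index d s -> fn) :
  jet Omega u w -> measurable_fun D u.
Proof. by move=> [<- jw]; case: (jw [ffun=> ord0]) => //; rewrite mdeg0. Qed.

(** The energy is an infimum over jets, and it is +oo over the empty set. *)
Lemma HF_jet s u : HF Omega s u ->
  exists w : multi_index d s -> fn, jet Omega u w.
Proof.
rewrite /HF /= /sobolev_energy => uoo; apply: contrapT => nw.
move: uoo; rewrite [X in ereal_inf X](_ : _ = set0) ?ereal_inf0 ?ltxx//.
by apply/seteqP; split => // y [w jw _]; apply: nw; exists w.
Qed.

Lemma HF_measurable s u : HF Omega s u -> measurable_fun D u.
Proof. by move=> /HF_jet[w]; exact: jet_measurable. Qed.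

Lemma jet_energy_ge0 s (w : multi_index d s -> fn) : (0 <= jet_energy Omega w)%E.
Proof.
apply: adde_ge0.
  apply: sume_ge0 => b _; apply: integral_ge0 => x _.
  by rewrite lee_fin sqr_ge0.
by case: ifP => // _; apply: sume_ge0 => b _; exact: slobodeckij_ge0.
Qed.

Lemma sobolev_energy_ge0 s (u : fn) : (0 <= sobolev_energy Omega s u)%E.
Proof. by apply/ereal_infP => _ [w _ <-]; exact: jet_energy_ge0. Qed.

Lemma multi_index0 (b : multi_index d (0 : R)) : b = [ffun=> ord0].
Proof.
apply/ffunP => i; apply: val_inj; rewrite ffunE /=.
by case: (b i) => m /=; rewrite truncn0 ltnS leqn0 => /eqP.
Qed.

Lemma jet_energy0 (w : multi_index d (0 : R) -> fn) :
  (jet_energy Omega w = \int[leb]_(x in D) (w [ffun=> ord0] x ^+ 2)%:E)%E.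
Proof.
have -> : jet_energy Omega w = (\sum_(b | (mdeg b <= Num.truncn (0 : R))%N)
    \int[leb]_(x in D) (w b x ^+ 2)%:E)%E.
  have k0 : (Num.truncn (0 : R))%:R = 0 :> R by rewrite truncn0.
  by rewrite /jet_energy /= [X in 0 - X]k0 subrr eqxx adde0.
rewrite (big_pred1 [ffun=> ord0]) // => b /=.
by apply/idP/eqP => [_|->]; [exact: multi_index0|rewrite mdeg0].
Qed.

Lemma HF0P (u : fn) : HF Omega 0 u <-> L2 u.
Proof.
split=> [Hu|[mu uoo]].
  split; first exact: HF_measurable Hu.
  have [w jw] := HF_jet Hu; apply: le_lt_trans Hu.
  apply/ereal_infP => _ [v [v0 _] <-].
  by rewrite jet_energy0 v0.
apply: le_lt_trans uoo; apply: ereal_inf_lbound.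
exists (fun=> u); last by rewrite jet_energy0.
split => // b _; split => //; rewrite (multi_index0 b); exact: weak_deriv0.
Qed.

Lemma HF_norm0 (u : fn) : L2 u ->
  HF_norm Omega 0 u = Num.sqrt (\int[leb]_(x in D) (u x * u x)).
Proof.
move=> [mu _]; rewrite /HF_norm; congr (Num.sqrt (fine _)); apply/eqP.
rewrite eq_le; apply/andP; split.
  apply: ereal_inf_lbound.
  exists (fun=> u); last by rewrite jet_energy0.
  split => // b _; split => //; rewrite (multi_index0 b); exact: weak_deriv0.
apply/ereal_infP => _ [v [v0 _] <-].
by rewrite jet_energy0 v0.
Qed.

Lemma HF_L2 s (u : fn) : 0 <= s -> HF Omega s u -> L2 u.
Proof. by move=> s0 Hu; apply/HF0P; case: (nested (lexx 0) s0) => + _; exact. Qed.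

Lemma HF_norm_ge0 s (u : fn) : 0 <= HF_norm Omega s u.
Proof. exact: sqrtr_ge0. Qed.

Lemma HF_scale s (u u' : fn) c : HF Omega s u -> measurable_fun D u' ->
  (\forall x \ae leb, D x -> u' x = c * u x) ->
  HF Omega s u' /\ HF_norm Omega s u' <= `|c| * HF_norm Omega s u.
Proof.
move=> Hu mu' uu'.
have le : (sobolev_energy Omega s u' <= (c ^+ 2)%:E * sobolev_energy Omega s u)%E.
  have le_jet (w : multi_index d s -> fn) : jet Omega u w ->
      (sobolev_energy Omega s u' <= (c ^+ 2)%:E * jet_energy Omega w)%E.
    move=> jw; have [w' jw' <-] := jet_scale oOmega jw mu' uu'.
    by apply: ereal_inf_lbound; exists w'.
  (* For c = 0 the factor cannot be divided out, but a single jet already bounds the energy by 0. *)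
  have [c0|c0] := eqVneq c 0.
    have [w jw] := HF_jet Hu; move: (le_jet w jw).
    by rewrite c0 expr0n /= !mul0e.
  rewrite -lee_pdivrMl ?exprn_even_gt0//; apply/ereal_infP => _ [w jw <-].
  by rewrite lee_pdivrMl ?exprn_even_gt0//; exact: le_jet.
have ufin : sobolev_energy Omega s u \is a fin_num.
  by rewrite ge0_fin_numE ?sobolev_energy_ge0.
have uoo' : (sobolev_energy Omega s u' < +oo)%E.
  by apply: le_lt_trans le _; rewrite -(fineK ufin) -EFinM ltry.
split => //; rewrite -sqrtr_sqr /HF_norm -sqrtrM ?sqr_ge0//; apply: ler_wsqrtr.
have <- : fine ((c ^+ 2)%:E * sobolev_energy Omega s u) =
    c ^+ 2 * fine (sobolev_energy Omega s u) by rewrite fineM.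
apply: fine_le => //; first by rewrite ge0_fin_numE ?sobolev_energy_ge0.
by rewrite fin_numM.
Qed.

Lemma HF_zero s : HF Omega s (fun=> 0) /\ HF_norm Omega s (fun=> 0) = 0.
Proof.
pose w (b : multi_index d s) : fn := fun=> 0.
have jw : jet Omega (fun=> 0) w.
  split => // b _; split; first exact: measurable_cst.
  move=> phi _; under eq_Rintegral do rewrite mul0r.
  under [in RHS]eq_Rintegral do rewrite mul0r.
  by rewrite Rintegral_cst // !mul0r mulr0.
(* Scaling the zero jet by c = 0 yields a jet of energy 0 without evaluating any integral. *)
have [|w' jw'] := @jet_scale _ _ _ oOmega s _ (fun=> 0) 0 w jw (measurable_cst _).
  by apply: aeW => x _; rewrite mul0r.
rewrite expr0n mul0e => e0.
have E0 : sobolev_energy Omega s (fun=> 0) = 0%E.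
  apply/eqP; rewrite eq_le sobolev_energy_ge0 andbT -e0.
  by apply: ereal_inf_lbound; exists w'.
by rewrite /HF /HF_norm /= E0 /= sqrtr0.
Qed.

Lemma pivot_zero (phi : fn) : pivot Omega (fun=> 0) phi = 0.
Proof.
by rewrite /pivot; under eq_Rintegral do rewrite mul0r; rewrite Rintegral_cst // mul0r.
Qed.

Lemma pivotC (u v : fn) : pivot Omega u v = pivot Omega v u.
Proof. by apply: eq_Rintegral => x _; rewrite mulrC. Qed.

Lemma pivot_lin c (u v phi : fn) : L2 u -> L2 v -> L2 phi ->
  pivot Omega (c *: u + v) phi = c * pivot Omega u phi + pivot Omega v phi.
Proof. exact: Rintegral_lin_mul. Qed.

Lemma pivot_le (u v : fn) : L2 u -> L2 v ->
  `|pivot Omega u v| <= HF_norm Omega 0 u * HF_norm Omega 0 v.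
Proof.
by move=> Lu Lv; rewrite !HF_norm0//; exact: Rintegral_cauchy_schwarz.
Qed.

Lemma pivot_inj (u v : fn) : L2 u -> L2 v ->
  (forall phi, HF Omega 0 phi -> pivot Omega u phi = pivot Omega v phi) ->
  \forall x \ae leb, D x -> u x = v x.
Proof.
move=> Lu Lv uv.
have Lw : L2 (-1 *: v + u) by exact: square_integrable_lin.
have : pivot Omega (-1 *: v + u) (-1 *: v + u) = 0.
  by rewrite pivot_lin // uv ?mulN1r ?addNr //; exact/HF0P.
move=> /(Rintegral_sqr_eq0 mD Lw); apply: filterS => x H Dx.
by apply/eqP; rewrite -subr_eq0 addrC -mulN1r; exact/eqP/H.
Qed.

Lemma Hs_eqP s (f g : fn -> R) : 0 <= s ->
  Hs_eq Omega s f g <-> (forall phi, HF Omega 0 phi -> f phi = g phi).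
Proof. by move=> s0; rewrite /Hs_eq max_l ?oppr_le0. Qed.

(** Functions with the same pivot agree almost everywhere, so [HF_scale] with c = 1 applies in both
    directions. Norms in the scale thus do not depend on the function that [Hs_fun] selects. *)
Lemma HF_norm_eq s (u v : fn) : 0 <= s -> HF Omega s u -> HF Omega s v ->
  (forall phi, HF Omega 0 phi -> pivot Omega u phi = pivot Omega v phi) ->
  HF_norm Omega s u = HF_norm Omega s v.
Proof.
suff H a b : 0 <= s -> HF Omega s a -> HF Omega s b ->
    (forall phi, HF Omega 0 phi -> pivot Omega a phi = pivot Omega b phi) ->
    HF_norm Omega s a <= HF_norm Omega s b.
  move=> s0 Hu Hv uv; apply/eqP; rewrite eq_le !H//.
  by move=> phi Hp; rewrite uv.
move=> s0 Ha Hb ab; rewrite -[leRHS]mul1r -(normr1 R).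
apply: (HF_scale Hb (HF_measurable Ha) _).2.
have := pivot_inj (HF_L2 s0 Ha) (HF_L2 s0 Hb) ab.
by apply: filterS => x H Dx; rewrite mul1r H.
Qed.

Lemma Hs_funP s (f : fn -> R) : 0 <= s -> Hs Omega s f ->
  HF Omega s (Hs_fun Omega s f) /\
  (forall phi, HF Omega 0 phi -> f phi = pivot Omega (Hs_fun Omega s f) phi).
Proof.
move=> s0; rewrite /Hs /= s0 => -[u Hu fu]; rewrite /Hs_fun.
case: xgetP => [v _ [Hv /(Hs_eqP _ _ s0)]//|/(_ u)].
by case.
Qed.

Lemma HsP s (f : fn -> R) u : 0 <= s -> HF Omega s u ->
  (forall phi, HF Omega 0 phi -> f phi = pivot Omega u phi) -> Hs Omega s f.
Proof. by move=> s0 Hu fu; rewrite /Hs /= s0; exists u => //; exact/Hs_eqP. Qed.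

Lemma Hs_norm_pivot s (f : fn -> R) u : 0 <= s -> HF Omega s u ->
  (forall phi, HF Omega 0 phi -> f phi = pivot Omega u phi) ->
  Hs_norm Omega s f = HF_norm Omega s u.
Proof.
move=> s0 Hu fu; have [Hv fv] := Hs_funP s0 (HsP s0 Hu fu).
rewrite /Hs_norm s0; apply: HF_norm_eq => // phi Hp.
by rewrite -fv // fu.
Qed.

Lemma Hs_norm_ge0 s (f : fn -> R) : 0 <= Hs_norm Omega s f.
Proof.
rewrite /Hs_norm; case: ifP => _; first exact: HF_norm_ge0.
by apply: sup_ge0 => _ [u _ <-].
Qed.

Lemma Hs_norm_in_ge0 s t (f : fn -> R) : 0 <= Hs_norm_in Omega s t f.
Proof. by apply: inf_ge0 => _ [g _ <-]; exact: Hs_norm_ge0. Qed.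

Lemma Hs_le_norm s (f : fn -> R) u : s < 0 -> Hs Omega s f ->
  HF Omega (- s) u -> `|f u| <= Hs_norm Omega s f * HF_norm Omega (- s) u.
Proof.
move=> s0; rewrite /Hs /Hs_norm /= leNgt s0 /= => -[lin [K fK]] Hu.
have f0 : f 0 = 0.
  have Hz : HF Omega (- s) 0 by exact: (HF_zero (- s)).1.
  have := lin 1 0 0 Hz Hz; rewrite scale1r addr0 mul1r => /eqP.
  by rewrite -subr_eq0 opprD addrA subrr sub0r oppr_eq0 => /eqP.
have fZ c v : HF Omega (- s) v -> f (c *: v) = c * f v.
  move=> Hv; have := lin c v 0 Hv (HF_zero (- s)).1.
  by rewrite f0 !addr0.
set S := [set _ | _ in _].
have ubS : has_ubound S.
  exists `|K| => _ [v [Hv v1] <-]; rewrite (le_trans (fK v Hv)) //.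
  rewrite (le_trans (ler_norm _)) // normrM ler_piMr //.
  by rewrite ger0_norm ?HF_norm_ge0.
(* A function of norm 0 need not be 0 and cannot be normalized; the constant [K] from membership in
   the dual gives [f u] = 0. *)
have [N0|N0] := eqVneq (HF_norm Omega (- s) u) 0.
  by have := fK u Hu; rewrite N0 !mulr0.
have Np : 0 < HF_norm Omega (- s) u by rewrite lt_neqAle eq_sym N0 HF_norm_ge0.
set N := HF_norm _ _ _ in N0 Np *.
have [Hv vN] : HF Omega (- s) (N^-1 *: u) /\
    HF_norm Omega (- s) (N^-1 *: u) <= `|N^-1| * N.
  apply: HF_scale => //; last by apply: aeW.
  by apply: measurable_funM => //; exact: HF_measurable Hu.
rewrite -ler_pdivrMr // mulrC -(gtr0_norm Np) -normfV -normrM -fZ //.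
apply: sup_upper_bound.
  by split => //; exists `|f (N^-1 *: u)|, (N^-1 *: u) => //; split => //;
    rewrite (le_trans vN) // normfV gtr0_norm // mulVf.
exists (N^-1 *: u) => //; split => //.
by rewrite (le_trans vN) // normfV gtr0_norm // mulVf.
Qed.

Lemma HF_nested s t : 0 <= s -> s <= t -> exists2 K, 0 <= K &
  forall u, HF Omega t u -> HF Omega s u /\ HF_norm Omega s u <= K * HF_norm Omega t u.
Proof.
move=> s0 st; have [H [K HK]] := nested s0 st; exists `|K| => // u Hu.
split; first exact: H.
by rewrite (le_trans (HK u Hu))// ler_wpM2r ?HF_norm_ge0 ?ler_norm.
Qed.

(** Three cases. For 0 <= s the function spaces are nested; for s < 0 <= t the pivot is bounded on
    H^(-s) by Cauchy-Schwarz in L^2; for t < 0 the functional is restricted to the smaller space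
    H^(-s). *)
Lemma Hs_incl s t (f : fn -> R) : s <= t -> Hs Omega t f -> Hs Omega s f.
Proof.
move=> st Hf; have [s0|s0] := leP 0 s.
  have t0 := le_trans s0 st; have [Hu fu] := Hs_funP t0 Hf.
  apply: (HsP s0 _ fu); have [K _ /(_ _ Hu)[]//] := HF_nested s0 st.
have ns0 : 0 <= - s by rewrite oppr_ge0 ltW.
have [t0|t0] := leP 0 t.
  have [Hu fu] := Hs_funP t0 Hf; have Lu := HF_L2 t0 Hu.
  rewrite /Hs /= leNgt s0 /=; split.
    move=> c v w /(HF_L2 ns0) Lv /(HF_L2 ns0) Lw.
    have Lvw : L2 (c *: v + w) by exact: square_integrable_lin.
    rewrite !fu; try exact/HF0P.
    by rewrite ![pivot _ (Hs_fun _ _ _) _]pivotC pivot_lin.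
  have [K K0 HK] := HF_nested (lexx 0) ns0.
  exists (HF_norm Omega 0 (Hs_fun Omega t f) * K) => v Hv.
  have [Hv0 vK] := HK v Hv.
  rewrite fu // -mulrA (le_trans (pivot_le Lu _)) //; first exact/HF0P.
  by rewrite ler_wpM2l ?HF_norm_ge0.
have nst : - t <= - s by rewrite lerN2.
have nt0 : 0 <= - t by rewrite oppr_ge0 ltW.
have [K K0 HK] := HF_nested nt0 nst.
move: Hf; rewrite /Hs /= !leNgt s0 t0 /= => -[lin [L fL]]; split.
  by move=> c u v /HK[Hu _] /HK[Hv _]; exact: lin.
exists (`|L| * K) => u /HK[Hu uK]; rewrite (le_trans (fL u Hu)) //.
rewrite -mulrA (le_trans (ler_norm _)) // normrM ler_wpM2l //.
by rewrite ger0_norm ?HF_norm_ge0.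
Qed.

Lemma Hs_zero s : Hs Omega s 0 /\ Hs_norm Omega s 0 = 0.
Proof.
have [s0|s0] := leP 0 s.
  have p0 phi : HF Omega 0 phi -> (0 : fn -> R) phi = pivot Omega (fun=> 0) phi.
    by move=> _; rewrite pivot_zero.
  have [Hz nz] := HF_zero s.
  by split; [exact: HsP p0|rewrite (Hs_norm_pivot s0 Hz p0)].
rewrite /Hs /Hs_norm /= leNgt s0 /=; split.
  split; first by move=> c u v _ _; rewrite mulr0 addr0.
  by exists 0 => u _; rewrite normr0 mul0r.
apply/eqP; rewrite eq_le; apply/andP; split; last by apply: sup_ge0 => _ [u _ <-].
have [Hz nz] := HF_zero (- s).
apply: ge_sup => [|_ [u _ <-]]; last by rewrite normr0.
by exists 0, (fun=> 0); [rewrite /= nz ler01|rewrite normr0].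
Qed.

(** The approximation property [Q4] speaks of pairs; a zero component lets it be applied to one
    space at a time. *)
Lemma Hs_in_zero s t : Hs_in Omega s t 0 /\ Hs_norm_in Omega s t 0 = 0.
Proof.
have [H0 n0] := Hs_zero t; split; first by exists 0.
apply/eqP; rewrite eq_le Hs_norm_in_ge0 andbT -n0.
apply: ge_inf; first by exists 0 => _ [g _ <-]; exact: Hs_norm_ge0.
by exists 0.
Qed.

(** That a functional on functions respects equality almost everywhere has to be derived: the
    difference is 0 times u almost everywhere, hence of norm 0, and [f] is bounded. *)
Lemma Hs_ae_eq s (f : fn -> R) u v : s < 0 -> Hs Omega s f ->
  HF Omega (- s) u -> HF Omega (- s) v ->
  (forall phi, HF Omega 0 phi -> pivot Omega u phi = pivot Omega v phi) ->
  f u = f v.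
Proof.
move=> s0 Hf Hu Hv uv; have ns0 : 0 <= - s by rewrite oppr_ge0 ltW.
have aeuv := pivot_inj (HF_L2 ns0 Hu) (HF_L2 ns0 Hv) uv.
have [Hw nw] : HF Omega (- s) (-1 *: u + v) /\
    HF_norm Omega (- s) (-1 *: u + v) <= `|0 : R| * HF_norm Omega (- s) u.
  apply: (HF_scale Hu).
    apply: measurable_funD; last exact: HF_measurable Hv.
    by apply: measurable_funM => //; exact: HF_measurable Hu.
  apply: filterS aeuv => x H Dx.
  by rewrite -[LHS]/(-1 * u x + v x) H // mulN1r addNr mul0r.
have := Hs_le_norm s0 Hf Hw.
move: (Hf); rewrite /Hs /= leNgt s0 /= => -[-> // _].
rewrite normr0 mul0r in nw.
move=> fw; have := le_trans fw (ler_wpM2l (Hs_norm_ge0 s f) nw).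
by rewrite mulr0 normr_le0 mulN1r addrC subr_eq0 eq_sym => /eqP.
Qed.

(** Provides the boundedness of v |-> [J1 v u] on [V1], by which the dual problem with data
    [pivot u] is solvable. *)
Lemma Hs_eval_bounded s u : HF Omega (Num.max 0 (- s)) u ->
  exists K, forall f, Hs Omega s f -> `|f u| <= K * Hs_norm Omega s f.
Proof.
have [s0|s0] := leP 0 s; last first.
  rewrite max_r ?oppr_ge0 ?ltW // => Hu; exists (HF_norm Omega (- s) u) => f Hf.
  by rewrite mulrC; exact: Hs_le_norm.
rewrite max_l ?oppr_le0 // => Hu; have [K K0 HK] := HF_nested (lexx 0) s0.
exists (HF_norm Omega 0 u * K) => f Hf; have [Hv fv] := Hs_funP s0 Hf.
have Lu : L2 u by exact/HF0P.
rewrite fv // pivotC (le_trans (pivot_le Lu (HF_L2 s0 Hv))) //.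
rewrite -mulrA ler_wpM2l ?HF_norm_ge0 // (Hs_norm_pivot s0 Hv fv).
by have [_ ->] := HK _ Hv.
Qed.

(** Both branches of [Hs_pair] reduce to evaluation at u: for s >= 0 by symmetry of the pivot, for s
    < 0 because the function selected for the pivot equals u almost everywhere. *)
Lemma Hs_pair_pivot s t u (f : fn -> R) : 0 <= t -> - s <= t ->
  HF Omega t u -> Hs Omega s f -> Hs_pair Omega s (pivot Omega u) f = f u.
Proof.
move=> t0 st Hu Hf; rewrite /Hs_pair; case: ifPn => [s0|].
  have [Hv fv] := Hs_funP s0 Hf.
  by rewrite pivotC fv //; exact/HF0P/(HF_L2 t0 Hu).
rewrite -ltNge => s0; have ns0 : 0 <= - s by rewrite oppr_ge0 ltW.
have [K _ /(_ u Hu)[Hu' _]] := HF_nested ns0 st.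
have [Hv fv] := Hs_funP ns0 (HsP ns0 Hu' (fun phi _ => erefl)).
by apply: (Hs_ae_eq s0 Hf) => // phi Hp; rewrite -fv.
Qed.

End sobolev_scale.

(** * Hilbert spaces and Galerkin projections *)

Definition linear_functional (R : realType) (U : lmodType R) (f : U -> R) :=
  forall c x y, f (c *: x + y) = c * f x + f y.

Section linear_functional.
Context (R : realType) (U : lmodType R) (f : U -> R).
Hypothesis lin : linear_functional f.

Lemma lfun0 : f 0 = 0.
Proof. by have := lin (-1) 0 0; rewrite scaler0 addr0 mulN1r addNr. Qed.

Lemma lfunD x y : f (x + y) = f x + f y.
Proof. by have := lin 1 x y; rewrite scale1r mul1r. Qed.

Lemma lfunZ c x : f (c *: x) = c * f x.
Proof. by have := lin c x 0; rewrite lfun0 !addr0. Qed.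

Lemma lfunN x : f (- x) = - f x.
Proof. by rewrite -scaleN1r lfunZ mulN1r. Qed.

Lemma lfunB x y : f (x - y) = f x - f y.
Proof. by rewrite lfunD lfunN. Qed.

Lemma lfun_sum n (c : 'I_n -> R) (e : 'I_n -> U) :
  f (\sum_(i < n) c i *: e i) = \sum_(i < n) c i * f (e i).
Proof. by rewrite (big_morph f lfunD lfun0); apply: eq_bigr => i _; exact: lfunZ. Qed.

End linear_functional.

Definition bilinear_form (R : realType) (U V : lmodType R) (B : U -> V -> R) :=
  (forall v, linear_functional (B^~ v)) /\ (forall u, linear_functional (B u)).

Section hilbert_theory.
Context (R : realType) (V : completeNormedModType R) (ip : {dot V for idfun}).
Hypothesis hV : hilbert_norm ip.

Lemma dotC x y : ip x y = ip y x.
Proof. by rewrite hermC mul1r. Qed.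

Lemma dot_linr x : linear_functional (ip x).
Proof. by move=> c y z; rewrite linearPr. Qed.

Lemma dot_linl y : linear_functional (ip^~ y).
Proof. by move=> c x z; rewrite /= dotC dot_linr !(dotC y). Qed.

Lemma dot_le x y : `|ip x y| <= `|x| * `|y|.
Proof.
rewrite -ler_sqr ?nnegrE ?mulr_ge0 // -normrX ger0_norm ?sqr_ge0 // exprMn mulrC.
rewrite mulrC; apply: sqr_le_of_quadratic_ge0 => [|t]; first exact: sqr_ge0.
have := sqr_ge0 `|t *: y + x|; rewrite hV dot_linl !dot_linr (dotC y x) -!hV.
by rewrite (_ : t * _ + _ = `|x| ^+ 2 + t * ip x y *+ 2 + t ^+ 2 * `|y| ^+ 2) //; ring.
Qed.

(* A sequence minimizing |x|^2 - 2 f x is Cauchy and converges to the         *)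
(* representing vector.                                                       *)
Lemma riesz (f : V -> R) : linear_functional f ->
  (exists K, forall x, `|f x| <= K * `|x|) -> exists r, forall x, f x = ip r x.
Proof.
move=> lf [K fK]; pose J x := `|x| ^+ 2 - f x *+ 2.
have J_ge x : - K ^+ 2 <= J x.
  rewrite /J; have := fK x; rewrite ler_norml => /andP[_ fx].
  have := sqr_ge0 (`|x| - K); nra.
have infJ : has_inf (range J).
  by split; [exists (J 0), 0|exists (- K ^+ 2) => _ [x _ <-]].
have approx n : exists x, forall y, `|ip x y - f y| <= n.+1%:R^-1 * `|y|.
  (* Minimality up to (n+1)^(-2) makes a quadratic in t nonnegative, and its discriminant bounds the
     residual by |y|/(n+1). *)
  have e_gt0 : 0 < (n.+1%:R^-1 : R) ^+ 2 by rewrite exprn_gt0.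
  have [_ [x _ <-] Jx] := inf_adherent e_gt0 infJ.
  exists x => y; rewrite -ler_sqr ?nnegrE ?mulr_ge0 // real_normK ?num_real //.
  rewrite exprMn; apply: sqr_le_of_quadratic_ge0 => [|t]; first exact: sqr_ge0.
  have : inf (range J) <= J (t *: y + x) by apply: ge_inf; [case: infJ|exists (t *: y + x)].
  move: Jx; rewrite /J !hV lf dot_linl !dot_linr (dotC y x) => Jx Jy.
  have := lt_le_trans Jx (lerD Jy (lexx _)).
  rewrite -subr_gt0 => /ltW; congr (_ <= _); ring.
have [x xP] := choice approx.
have xC n m : `|x n - x m| <= n.+1%:R^-1 + m.+1%:R^-1.
  have [->|nz] := eqVneq (`|x n - x m|) 0; first by rewrite addr_ge0.
  rewrite -(@ler_pM2r _ `|x n - x m|); last by rewrite lt_neqAle eq_sym nz /=.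
  rewrite -expr2 hV; set y := x n - x m.
  rewrite [ip y y](_ : _ = (ip (x n) y - f y) - (ip (x m) y - f y)).
    rewrite mulrDl (le_trans (ler_norm _)) // (le_trans (ler_normB _ _)) //.
    by rewrite lerD.
  by rewrite (lfunB (dot_linl _)); ring.
have cx : cvg (x n @[n --> \oo]).
  apply/cauchy_cvgP/cauchy_exP => e e0.
  have e2 : 0 < e / 2 by exact: divr_gt0.
  near \oo => N; exists (x N).
  change (\forall n \near \oo, ball (x N) e (x n)); near=> n.
  rewrite -ball_normE /= (le_lt_trans (xC _ _)) // (splitr e) ltrD //.
    by near: N; exact: (near_infty_natSinv_lt (PosNum e2)).
  by near: n; exact: (near_infty_natSinv_lt (PosNum e2)).
exists (lim (x n @[n --> \oo])) => y; set r := lim _.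
have xr : x n @[n --> \oo] --> r by [].
apply/esym/eqP; rewrite -subr_eq0 -normr_eq0 eq_le normr_ge0 andbT.
apply/ler_addgt0Pr => e e0; rewrite add0r.
have d0 : 0 < e / (2 * (`|y| + 1)) by rewrite divr_gt0 // mulr_gt0 // ltr_wpDl.
near \oo => N.
have xN : `|r - x N| < e / (2 * (`|y| + 1)).
  by near: N; move/cvgrPdist_lt : xr; exact.
have N1 : N.+1%:R^-1 < e / (2 * (`|y| + 1)).
  by near: N; exact: (near_infty_natSinv_lt (PosNum d0)).
rewrite (_ : ip r y - f y = ip (r - x N) y + (ip (x N) y - f y)); last first.
  by rewrite (lfunB (dot_linl _)); ring.
rewrite (le_trans (ler_normD _ _)) // (le_trans (lerD (dot_le _ _) (xP _ _))) //.
rewrite -mulrDl (@le_trans _ _ ((e / (`|y| + 1)) * `|y|)) //.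
  rewrite ler_wpM2r // (le_trans (lerD (ltW xN) (ltW N1))) //.
  by rewrite -mulr2n invfM mulrA -mulrnAl -[e * _ *+ 2]mulr_natr divfK.
by rewrite mulrAC ler_pdivrMr ?ltr_wpDl // ler_pM2l // lerDl.
Unshelve. all: by end_near. Qed.

End hilbert_theory.

Section galerkin_theory.
Context (R : realType).

Lemma fin_dim_lin (V : lmodType R) (S : set V) c x y :
  fin_dim_subspace S -> S x -> S y -> S (c *: x + y).
Proof.
move=> [n [e ->]] [a _ <-] [b _ <-]; exists (fun i => c * a i + b i) => //.
rewrite scaler_sumr -big_split; apply: eq_bigr => i _.
by rewrite scalerDl scalerA.
Qed.

Lemma fin_dimB (V : lmodType R) (S : set V) x y :
  fin_dim_subspace S -> S x -> S y -> S (x - y).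
Proof. by move=> fS Sx Sy; rewrite -scaleN1r addrC; exact: fin_dim_lin. Qed.

Lemma fin_dim0 (V : lmodType R) (S : set V) : fin_dim_subspace S -> S 0.
Proof.
by move=> [n [e ->]]; exists (fun=> 0) => //; rewrite big1 // => i _; rewrite scale0r.
Qed.

Lemma fin_dimN (V : lmodType R) (S : set V) x :
  fin_dim_subspace S -> S x -> S (- x).
Proof. by move=> fS Sx; rewrite -sub0r; apply: fin_dimB => //; exact: fin_dim0. Qed.

Lemma fin_dim_prod (U V : lmodType R) (S : set U) (T : set V) :
  fin_dim_subspace S -> fin_dim_subspace T -> fin_dim_subspace (S `*` T).
Proof.
move=> [n [e ->]] [m [f ->]]; exists (n + m)%N.
pose g k : U * V := match fintype.split k with inl i => (e i, 0) | inr j => (0, f j) end.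
have gE (c : 'I_(n + m) -> R) : \sum_(k < n + m) c k *: g k =
    (\sum_(i < n) c (lshift m i) *: e i, \sum_(j < m) c (rshift n j) *: f j).
  rewrite big_split_ord /=.
  rewrite (eq_bigr (fun i => (c (lshift m i) *: e i, 0))); last first.
    by move=> i _; rewrite /g (unsplitK (inl i)); congr pair; rewrite /= scaler0.
  rewrite [X in _ + X](eq_bigr (fun j => (0, c (rshift n j) *: f j))); last first.
    by move=> j _; rewrite /g (unsplitK (inr j)); congr pair; rewrite /= scaler0.
  apply: injective_projections; rewrite /= !(raddf_sum fst, raddf_sum snd) /=.
    by rewrite [X in _ + X]big1 ?addr0.
  by rewrite [X in X + _]big1 ?add0r.
exists g; apply/seteqP; split => [[x y] [/= [a _ <-] [b _ <-]]|_ [c _ <-]].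
  exists (fun k => match fintype.split k with inl i => a i | inr j => b j end) => //.
  rewrite gE; congr pair; apply: eq_bigr => i _.
    by rewrite (unsplitK (inl i)).
  by rewrite (unsplitK (inr i)).
by rewrite gE; split; [exists (fun i => c (lshift m i))|exists (fun j => c (rshift n j))].
Qed.

Context (U V : lmodType R) (B : U -> V -> R) (S : set U) (T : set V).
Hypotheses (bB : bilinear_form B) (fS : fin_dim_subspace S)
  (fT : fin_dim_subspace T) (nB : nondegenerate_on B S T).

(* Solvability over spanning families: the row l_j = B u f_j lies in the row  *)
(* space of the matrix (B e_i f_j) since nondegeneracy forces every x in its  *)
(* kernel to satisfy sum_j x_j f_j = 0, hence l x = 0.                        *)
Lemma galerkin_formula : exists n m (e : 'I_n -> U) (f : 'I_m -> V) (P : 'M[R]_(m, n)),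
  forall u, let g := \sum_(i < n) (\sum_(j < m) B u (f j) * P j i) *: e i in
    S g /\ forall t, T t -> B g t = B u t.
Proof.
have [n [e eS]] := fS; have [m [f fTE]] := fT.
pose A := \matrix_(i < n, j < m) B (e i) (f j).
exists n, m, e, f, (pinvmx A) => u g.
have Sg : S g by rewrite eS; exists (fun i => \sum_(j < m) B u (f j) * pinvmx A j i).
split => // t; rewrite fTE => -[c _ <-].
pose l := \row_j B u (f j).
have lA : (l <= A)%MS.
  rewrite submxE; apply/eqP/rowP => k; rewrite !mxE.
  pose x j := cokermx A j k.
  have -> : \sum_j l 0 j * cokermx A j k = B u (\sum_j x j *: f j).
    rewrite (lfun_sum (bB.2 u)); apply: eq_bigr => j _.
    by rewrite mxE mulrC.
  have -> : \sum_j x j *: f j = 0; last exact: (lfun0 (bB.2 u)).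
  apply: nB.2 => [|s]; first by rewrite fTE; exists x.
  rewrite eS => -[b _ <-]; rewrite (lfun_sum (bB.1 _)) big1 // => i _.
  rewrite (lfun_sum (bB.2 _)) -[X in b i * X](_ : (A *m cokermx A) i k = _).
    by rewrite mulmx_coker mxE mulr0.
  by rewrite mxE; apply: eq_bigr => j _; rewrite mxE mulrC.
rewrite (lfun_sum (bB.2 g)) (lfun_sum (bB.2 u)); apply: eq_bigr => j _.
congr (_ * _); have /rowP /(_ j) := mulmxKpV lA.
rewrite [RHS]mxE => <-; rewrite mxE /g (lfun_sum (bB.1 _)).
apply: eq_bigr => i _; rewrite [A i j]mxE mxE; congr (_ * _).
by apply: eq_bigr => k _; rewrite [l 0 k]mxE.
Qed.

Lemma galerkinP u :
  S (galerkin B S T u) /\ forall t, T t -> B (galerkin B S T u) t = B u t.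
Proof.
rewrite /galerkin; case: xgetP => [g _ []//|].
have [n [m [e [f [P /(_ u) H]]]]] := galerkin_formula.
by move=> /(_ _ H).
Qed.

Lemma galerkin_unique u g :
  S g -> (forall t, T t -> B g t = B u t) -> galerkin B S T u = g.
Proof.
have [SG BG] := galerkinP u => Sg Bg; apply/eqP; rewrite -subr_eq0; apply/eqP.
apply: nB.1 => [|t Tt]; first exact: fin_dimB.
by rewrite (lfunB (bB.1 t)) BG // Bg // subrr.
Qed.

End galerkin_theory.

(** The projection factors through the finitely many numbers [B u (f j)], each bounded by a multiple
    of |u|. [K] may depend on the subspaces; it only serves to show that some
    quasi-best-approximation constant exists. *)
Lemma galerkin_bounded (R : realType) (U V : normedModType R) (B : U -> V -> R)
    (S : set U) (T : set V) :
  bilinear_form B -> bounded_form B -> fin_dim_subspace S -> fin_dim_subspace T ->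
  nondegenerate_on B S T ->
  exists2 K, 0 <= K & forall u, `|galerkin B S T u| <= K * `|u|.
Proof.
move=> bB [K BK] fS fT nB.
have [n [m [e [f [P H]]]]] := galerkin_formula bB fS fT nB.
exists (\sum_(i < n) (\sum_(j < m) `|K| * `|f j| * `|P j i|) * `|e i|).
  by apply: sumr_ge0 => i _; rewrite mulr_ge0 // sumr_ge0 // => j _; rewrite !mulr_ge0.
move=> u; have [Sg Bg] := H u.
rewrite (galerkin_unique bB fS fT nB Sg Bg) mulr_suml.
apply: (le_trans (ler_norm_sum _ _ _)); apply: ler_sum => i _.
rewrite normrZ mulrAC ler_wpM2r // mulr_suml.
apply: (le_trans (ler_norm_sum _ _ _)); apply: ler_sum => j _.
rewrite normrM mulrAC ler_wpM2r // (le_trans (BK _ _)) //.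
by rewrite mulrAC ler_wpM2r // ler_wpM2r // ler_norm.
Qed.

Section quasi_best.
Context (R : realType) (U : lmodType R) (nrm : U -> R) (S : set U) (P : U -> U).
Hypothesis nrm_ge0 : forall u, 0 <= nrm u.

Lemma best_error_ge0 u : 0 <= best_error nrm S u.
Proof. by apply: inf_ge0 => _ [w _ <-]. Qed.

Lemma best_error_le u w : S w -> best_error nrm S u <= nrm (u - w).
Proof.
move=> Sw; apply: ge_inf; last by exists w.
by exists 0 => _ [v _ <-].
Qed.

Lemma le_best_error u x : S !=set0 -> (forall w, S w -> x <= nrm (u - w)) ->
  x <= best_error nrm S u.
Proof.
move=> [w0 Sw0] H; apply: lb_le_inf; first by exists (nrm (u - w0)), w0.
by move=> _ [w Sw <-]; exact: H.
Qed.

Lemma le_best_errorM u x r : S !=set0 -> 0 <= r ->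
  (forall w, S w -> x <= r * nrm (u - w)) -> x <= r * best_error nrm S u.
Proof.
move=> S0; rewrite le_eqVlt => /predU1P[<- H|r0 H].
  by have [w Sw] := S0; have := H w Sw; rewrite !mul0r.
rewrite -ler_pdivrMl //; apply: le_best_error => // w Sw.
by rewrite ler_pdivrMl //; exact: H.
Qed.

Lemma quasi_best_const_le m : 1 <= m ->
  (forall u, nrm (u - P u) <= m * best_error nrm S u) ->
  quasi_best_const nrm S P <= m.
Proof. by move=> m1 Pm; apply: ge_inf; [exists 1 => x []|split]. Qed.

(** The infimum is attained because the conditions on m are closed, and free of m where the best
    error is 0. One admissible m has to be supplied since [inf] of the empty set is 0. *)
Lemma quasi_best_constP : (exists2 m, 1 <= m &
    forall u, nrm (u - P u) <= m * best_error nrm S u) ->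
  1 <= quasi_best_const nrm S P /\
  forall u, nrm (u - P u) <= quasi_best_const nrm S P * best_error nrm S u.
Proof.
move=> [m m1 Pm]; set X := [set m | 1 <= m /\
  forall u, nrm (u - P u) <= m * best_error nrm S u].
have X0 : X !=set0 by exists m; split.
split; first by apply: lb_le_inf => // x [].
move=> u; have [b0|b0] := eqVneq (best_error nrm S u) 0.
  by have := Pm u; rewrite b0 !mulr0.
have bp : 0 < best_error nrm S u by rewrite lt_neqAle eq_sym b0 best_error_ge0.
rewrite -ler_pdivrMr //; apply: lb_le_inf => // k [_ Pk].
by rewrite ler_pdivrMr.
Qed.

End quasi_best.

(** * The constraint form as an isometry between the two spaces *)

Section isometric_form.
Context (R : realType) (V1 V2 : completeNormedModType R)
  (ip1 : {dot V1 for idfun}) (ip2 : {dot V2 for idfun}).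
Hypotheses (h1 : hilbert_norm ip1) (h2 : hilbert_norm ip2).
Variable a : V1 -> V2 -> R.
Hypotheses (ba : bilinear_form a) (a_bounded : bounded_form a)
  (a_nondeg : forall v1, (forall v2, a v1 v2 = 0) -> v1 = 0)
  (norm2 : forall v2 : V2,
     `|v2| = sup [set a phi1 v2 | phi1 in [set phi1 : V1 | `|phi1| = 1]]).

(** [T v2] is the Riesz representative of a(-, v2). The prescribed norm says that T is isometric,
    polarization makes it preserve inner products, and nondegeneracy of [a] makes it onto.
    Continuity with constant 1, exact partners and solvability of both dual problems become facts
    about one inner product. *)
Lemma isometric_representation : exists T : V2 -> V1,
  [/\ forall v1 v2, a v1 v2 = ip1 v1 (T v2),
      forall v2, `|T v2| = `|v2|,
      forall x y, ip1 (T x) (T y) = ip2 x y &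
      forall v1, exists v2, T v2 = v1].
Proof.
have [K aK] := a_bounded.
have /choice[T aT] : forall v2, exists r, forall v1, a v1 v2 = ip1 v1 r.
  move=> v2; have [|r ar] := riesz h1 (ba.1 v2).
    by exists (K * `|v2|) => v1; rewrite mulrAC; exact: aK.
  by exists r => v1; rewrite ar dotC.
have iso v2 : `|T v2| = `|v2|.
  rewrite norm2; set S := [set _ | _ in _].
  have ubS : ubound S `|T v2|.
    move=> _ [v1 v11 <-]; rewrite aT (le_trans (ler_norm _)) //.
    by rewrite (le_trans (dot_le h1 _ _)) // v11 mul1r.
  apply/eqP; rewrite eq_le; apply/andP; split; last first.
    have [->|/set0P S0] := eqVneq S set0; first by rewrite sup0.
    exact: ge_sup.
  (* This case includes [V1] = 0, where there are no unit vectors. Otherwise the supremum is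
     attained at the normalized [T v2]. *)
  have [T0|T0] := eqVneq (T v2) 0.
    by rewrite T0 normr0 -norm2.
  have nT0 : `|T v2| != 0 by rewrite normr_eq0.
  apply: ub_le_sup; first by exists `|T v2|.
  exists (`|T v2|^-1 *: T v2); first by rewrite /= normrZ normfV normr_id mulVf.
  by rewrite aT (lfunZ (dot_linl _ _)) -h1 expr2 mulKf.
have TD x y : T (x + y) = T x + T y.
  apply/eqP; rewrite -subr_eq0 -normr_eq0 -sqrf_eq0 h1.
  set z := T (x + y) - _.
  by rewrite {2}/z (lfunB (dot_linr _ _)) (lfunD (dot_linr _ _)) -!aT
    (lfunD (ba.2 _)) subrr.
have polar x y : ip1 (T x) (T y) = ip2 x y.
  have := congr1 (fun r => r ^+ 2) (iso (x + y)).
  rewrite h1 h2 TD !(lfunD (dot_linr _ _)) !(lfunD (dot_linl _ _)).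
  rewrite -!h1 -!h2 !iso.
  rewrite (dotC ip1 (T y)) (dotC ip2 y); lra.
exists T; split => // v1.
(* y represents a(v1, -) in [V2]; since T preserves inner products, [T y] and v1 pair equally with
   every v2. *)
have [|y ay] := riesz h2 (ba.2 v1); first by exists (K * `|v1|) => v2; exact: aK.
exists y; apply/eqP; rewrite -subr_eq0; apply/eqP/a_nondeg => v2.
by rewrite (lfunB (ba.1 v2)) ay aT polar subrr.
Qed.

Lemma form_le v1 v2 : `|a v1 v2| <= `|v1| * `|v2|.
Proof.
have [T [aT iso _ _]] := isometric_representation.
by rewrite aT -iso dot_le.
Qed.

Lemma form_attained1 v1 : exists2 v2, `|v2| = `|v1| & a v1 v2 = `|v1| ^+ 2.
Proof.
have [T [aT iso _ /(_ v1)[v2 Tv2]]] := isometric_representation.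
by exists v2; [rewrite -Tv2 iso|rewrite aT Tv2 h1].
Qed.

Lemma form_attained2 v2 : exists2 v1, `|v1| = `|v2| & a v1 v2 = `|v2| ^+ 2.
Proof.
have [T [aT iso _ _]] := isometric_representation.
by exists (T v2); rewrite ?iso // aT -h1 iso.
Qed.

Lemma form_onto1 (f : V2 -> R) : linear_functional f ->
  (exists K, forall x, `|f x| <= K * `|x|) -> exists v1, a v1 = f.
Proof.
move=> lf bf; have [r fr] := riesz h2 lf bf.
have [T [aT _ polar _]] := isometric_representation.
by exists (T r); apply/funext => v2; rewrite aT polar fr.
Qed.

Lemma form_onto2 (f : V1 -> R) : linear_functional f ->
  (exists K, forall x, `|f x| <= K * `|x|) -> exists v2, a^~ v2 = f.
Proof.
move=> lf bf; have [r fr] := riesz h1 lf bf.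
have [T [aT _ _ /(_ r)[v2 Tv2]]] := isometric_representation.
by exists v2; apply/funext => v1; rewrite aT Tv2 dotC fr.
Qed.

Lemma inv_op_form1 (f : V2 -> R) : linear_functional f ->
  (exists K, forall x, `|f x| <= K * `|x|) -> a (inv_op a f) = f.
Proof.
move=> lf bf; rewrite /inv_op; case: xgetP => [v _ //|no].
by have [v av] := form_onto1 lf bf; case: (no v).
Qed.

Lemma inv_op_form2 (f : V1 -> R) : linear_functional f ->
  (exists K, forall x, `|f x| <= K * `|x|) ->
  a^~ (inv_op (fun v2 => a^~ v2) f) = f.
Proof.
move=> lf bf; rewrite /inv_op; case: xgetP => [v _ //|no].
by have [v av] := form_onto2 lf bf; case: (no v).
Qed.

End isometric_form.

Section operator_norms.
Context (R : realType).

Lemma le_op_norm (U V : normedModType R) (T : {linear U -> V}) :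
  bounded_op T -> forall u, `|T u| <= op_norm T * `|u|.
Proof.
move=> [K TK] u; have [->|u0] := eqVneq u 0; first by rewrite linear0 !normr0 mulr0.
have nu : 0 < `|u| by rewrite normr_gt0.
rewrite -ler_pdivrMr // mulrC -[`|u|^-1]gtr0_norm ?invr_gt0 // -normrZ -linearZ.
apply: ub_le_sup.
  exists `|K| => _ [v v1 <-]; rewrite (le_trans (TK v)) // (le_trans (ler_norm _)) //.
  by rewrite normrM normr_id ler_piMr.
exists (`|u|^-1 *: u) => //=.
by rewrite normrZ normfV normr_id mulVf // gt_eqF.
Qed.

Lemma le_form_norm (U V : normedModType R) (B : U -> V -> R) :
  bilinear_form B -> bounded_form B ->
  forall u v, `|B u v| <= form_norm B * `|u| * `|v|.
Proof.
move=> bB [K BK] u v.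
have [->|u0] := eqVneq u 0; first by rewrite (lfun0 (bB.1 v)) !normr0 mulr0 mul0r.
have [->|v0] := eqVneq v 0; first by rewrite (lfun0 (bB.2 u)) !normr0 mulr0.
have nu : 0 < `|u| by rewrite normr_gt0.
have nv : 0 < `|v| by rewrite normr_gt0.
have BK1 x y : `|x| <= 1 -> `|y| <= 1 -> `|B x y| <= `|K|.
  move=> x1 y1; rewrite (le_trans (BK x y)) // (le_trans (ler_norm _)) //.
  by rewrite !normrM !normr_id -mulrA ler_piMr // mulr_ile1.
have unit (V' : normedModType R) (x : V') : 0 < `|x| -> `| `|x|^-1 *: x | <= 1.
  by move=> nx; rewrite normrZ normfV normr_id mulVf // gt_eqF.
rewrite -ler_pdivrMr // -ler_pdivrMr //.
have -> : `|B u v| / `|v| / `|u| = `|B (`|u|^-1 *: u) (`|v|^-1 *: v)|.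
  rewrite (lfunZ (bB.1 _)) (lfunZ (bB.2 _)) !normrM !normfV !normr_id; ring.
apply: (@le_trans _ _ (dual_norm (B (`|u|^-1 *: u)))).
  apply: ub_le_sup.
    by exists `|K| => _ [y y1 <-]; apply: BK1 => //; exact: unit.
  by exists (`|v|^-1 *: v) => //; exact: unit.
apply: ub_le_sup; last by exists (`|u|^-1 *: u) => //; exact: unit.
exists `|K| => _ [x x1 <-]; apply: ge_sup; first by exists `|B x 0|, 0 => //=; rewrite normr0 ler01.
by move=> _ [y y1 <-]; exact: BK1.
Qed.

End operator_norms.

Section pair_norm_theory.
Context (R : realType).

Lemma euclid_cauchy_schwarz (x y z t : R) :
  x * z + y * t <= Num.sqrt (x ^+ 2 + y ^+ 2) * Num.sqrt (z ^+ 2 + t ^+ 2).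
Proof.
rewrite -sqrtrM ?addr_ge0 ?sqr_ge0 // (le_trans (ler_norm _)) // -sqrtr_sqr.
apply: ler_wsqrtr; have := sqr_ge0 (x * t - y * z); nra.
Qed.

Lemma ler_sqrt_sum_sqr (x y z t : R) : 0 <= x -> x <= z -> 0 <= y -> y <= t ->
  Num.sqrt (x ^+ 2 + y ^+ 2) <= Num.sqrt (z ^+ 2 + t ^+ 2).
Proof.
move=> x0 xz y0 yt; apply: ler_wsqrtr.
by apply: lerD; rewrite ler_sqr // nnegrE; [exact: le_trans x0 xz|exact: le_trans y0 yt].
Qed.

Lemma sqrt_sum_sqrM (c x y : R) : 0 <= c ->
  Num.sqrt ((c * x) ^+ 2 + (c * y) ^+ 2) = c * Num.sqrt (x ^+ 2 + y ^+ 2).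
Proof.
move=> c0; rewrite !exprMn -mulrDr sqrtrM ?sqr_ge0 // sqrtr_sqr ger0_norm //.
Qed.

Context (U V : normedModType R).

Lemma pair_norm_ge0 (x : U * V) : 0 <= pair_norm x.
Proof. exact: sqrtr_ge0. Qed.

Lemma pair_norm_triangle (x y : U * V) :
  pair_norm (x + y) <= pair_norm x + pair_norm y.
Proof.
have p2 (z : U * V) : pair_norm z ^+ 2 = `|z.1| ^+ 2 + `|z.2| ^+ 2.
  by rewrite sqr_sqrtr // addr_ge0 ?sqr_ge0.
rewrite -ler_sqr ?nnegrE ?addr_ge0 ?pair_norm_ge0 // sqrrD !p2 /=.
have cs := euclid_cauchy_schwarz `|x.1| `|x.2| `|y.1| `|y.2|.
rewrite -/(pair_norm x) -/(pair_norm y) in cs.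
have := ler_normD x.1 y.1; have := ler_normD x.2 y.2.
have := normr_ge0 (x.1 + y.1); have := normr_ge0 (x.2 + y.2).
rewrite mulr2n.
move: `|x.1 + y.1| `|x.2 + y.2| => r s s0 r0 sle rle.
have : r ^+ 2 <= (`|x.1| + `|y.1|) ^+ 2 by rewrite ler_sqr // nnegrE addr_ge0.
have : s ^+ 2 <= (`|x.2| + `|y.2|) ^+ 2 by rewrite ler_sqr // nnegrE addr_ge0.
move: cs; move: (pair_norm x * pair_norm y) => pp; nra.
Qed.

Lemma pair_normN (x : U * V) : pair_norm (- x) = pair_norm x.
Proof. by rewrite /pair_norm /= !normrN. Qed.

End pair_norm_theory.

(** * Comparison of the two projections *)

Section comparison.
Context (R : realType) (Q W V1 V2 : completeNormedModType R)
  (ipQ : {dot Q for idfun}) (ipW : {dot W for idfun})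
  (ip1 : {dot V1 for idfun}) (ip2 : {dot V2 for idfun}).
Hypotheses (hQ : hilbert_norm ipQ) (hW : hilbert_norm ipW)
  (h1 : hilbert_norm ip1) (h2 : hilbert_norm ip2).
Variable a : V1 -> V2 -> R.
Hypotheses (ba : bilinear_form a) (a_bounded : bounded_form a)
  (a_nondeg : forall v1, (forall v2, a v1 v2 = 0) -> v1 = 0)
  (norm2 : forall v2 : V2,
     `|v2| = sup [set a phi1 v2 | phi1 in [set phi1 : V1 | `|phi1| = 1]]).
Variables (Cs : V2 -> Q) (I : V1 -> W) (M : R).
Hypotheses (linCs : linear Cs) (linI : linear I)
  (CsM : forall v, `|Cs v| <= M * `|v|) (IM : forall v, `|I v| <= M * `|v|)
  (M_ge0 : 0 <= M).
Variables (S1 : set V1) (S2 : set V2).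
Hypotheses (fS1 : fin_dim_subspace S1) (fS2 : fin_dim_subspace S2)
  (nS : nondegenerate_on a S1 S2).

Local Notation R1 := (galerkin a S1 S2).
Local Notation R2 := (galerkin (fun v2 v1 => a v1 v2) S2 S1).
Local Notation mu := (quasi_best_const (fun v1 : V1 => `|v1|) S1 R1).
Local Notation S := (S1 `*` S2).

Let ba' : bilinear_form (fun v2 v1 => a v1 v2).
Proof. by split; case: ba. Qed.

Let nS' : nondegenerate_on (fun v2 v1 => a v1 v2) S2 S1.
Proof. by split; case: nS. Qed.

(** [R1] fixes [S1], so u and u - w have the same error, and boundedness of [R1] makes 1 + K an
    admissible constant. *)
Lemma ritz_quasi_best : 1 <= mu /\
  forall u, `|u - R1 u| <= mu * best_error (fun v1 : V1 => `|v1|) S1 u.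
Proof.
apply: quasi_best_constP => [u|]; first exact: normr_ge0.
have [K K0 RK] := galerkin_bounded ba a_bounded fS1 fS2 nS.
exists (1 + K) => [|u]; first by rewrite lerDl.
rewrite -ler_pdivrMl ?ltr_wpDr //; apply: le_best_error => [|w Sw].
  by exists 0; exact: fin_dim0.
rewrite ler_pdivrMl ?ltr_wpDr //.
have [SR aR] := galerkinP ba fS1 fS2 nS u.
have Rw : R1 (u - w) = R1 u - w.
  apply: galerkin_unique => //; first exact: fin_dimB.
  by move=> t St; rewrite !(lfunB (ba.1 t)) aR.
have -> : u - R1 u = (u - w) - R1 (u - w) by rewrite Rw; rewrite opprB addrA subrK.
by rewrite (le_trans (ler_normB _ _)) // mulrDl mul1r lerD.
Qed.

Lemma ritz1_le u w : S1 w -> `|u - R1 u| <= mu * `|u - w|.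
Proof.
move=> Sw; have [mu1 muP] := ritz_quasi_best.
rewrite (le_trans (muP u)) // ler_wpM2l //; first exact: le_trans ler01 mu1.
by apply: best_error_le.
Qed.

(* The adjoint Ritz projection has the same constant, because                 *)
(* a(x, v - R2 v) = a(x - R1 x, v - w).                                       *)
Lemma ritz2_le v w : S2 w -> `|v - R2 v| <= mu * `|v - w|.
Proof.
move=> Sw; have [mu1 _] := ritz_quasi_best.
have mu0 : 0 <= mu by exact: le_trans ler01 mu1.
have [SR aR] := galerkinP ba' fS2 fS1 nS' v.
have [x xv ax] := form_attained2 h1 h2 ba a_bounded a_nondeg norm2 (v - R2 v).
have [SR1 aR1] := galerkinP ba fS1 fS2 nS x.
have axE : a x (v - R2 v) = a (x - R1 x) (v - w).
  rewrite (lfunB (ba.1 _)) !(lfunB (ba.2 _)) -(aR _ SR1) -(aR1 _ SR) -(aR1 _ Sw).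
  by rewrite (aR _ SR1); ring.
have [->|nz] := eqVneq (v - R2 v) 0; first by rewrite normr0 mulr_ge0.
rewrite -(ler_pM2r (_ : 0 < `|v - R2 v|)) ?normr_gt0 // -expr2 -ax axE.
rewrite (le_trans (ler_norm _)) // -xv -mulrA [`|v - w| * _]mulrC mulrA.
rewrite (le_trans (form_le h1 h2 ba a_bounded a_nondeg norm2 _ _)) //.
rewrite ler_wpM2r // -{3}[x]subr0; apply: ritz1_le; exact: fin_dim0.
Qed.

Lemma ritz1_norm u : `|R1 u| <= (1 + mu) * `|u|.
Proof.
rewrite mulrDl mul1r -[R1 u](subKr u) (le_trans (ler_normB _ _)) // lerD2l.
by rewrite -{3}[u]subr0; apply: ritz1_le; exact: fin_dim0.
Qed.

Lemma ritz2_norm v : `|R2 v| <= (1 + mu) * `|v|.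
Proof.
rewrite mulrDl mul1r -[R2 v](subKr v) (le_trans (ler_normB _ _)) // lerD2l.
by rewrite -{3}[v]subr0; apply: ritz2_le; exact: fin_dim0.
Qed.

Variable alpha : R.
Hypothesis alpha_gt0 : 0 < alpha.
Local Notation lam := ((Num.sqrt alpha)^-1).
Local Notation b := (var_form a Cs I ipQ ipW alpha).

Let lam_gt0 : 0 < lam. Proof. by rewrite invr_gt0 sqrtr_gt0. Qed.

Lemma var_form_bilinear : bilinear_form b.
Proof.
have [al ar] := ba; have ll := dot_linl ipQ; have lr := dot_linr ipQ.
have wl := dot_linl ipW; have wr := dot_linr ipW.
split=> [[v1 v2] c [x1 x2] [y1 y2]|[v1 v2] c [x1 x2] [y1 y2]];
  rewrite /var_form /= al ar linCs linI.
  by rewrite ll wl; ring.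
by rewrite lr wr; ring.
Qed.

(* Testing with (-v1, v2) isolates the two squares of b. *)
Lemma var_form_sign v x : b v (- x.1, x.2) =
  a v.1 x.2 - a x.1 v.2 + lam * (ipQ (Cs v.2) (Cs x.2) + ipW (I v.1) (I x.1)).
Proof.
have IN u : I (- u) = - I u.
  have I0 : I 0 = 0.
    by have := linI (-1) 0 0; rewrite scaler0 addr0 scaleN1r addNr.
  by have := linI (-1) u 0; rewrite !scaleN1r I0 !addr0.
rewrite /var_form /= IN (lfunN (dot_linr _ _)) (lfunN (ba.1 _)); ring.
Qed.

(** Testing with (-v1, v2) forces [Cs v2] = 0 and [I v1] = 0; what remains of b is [a],
    nondegenerate on the discrete pair. *)
Lemma var_form_nondegenerate : nondegenerate_on b S S.
Proof.
have nondeg v : S v -> (forall u, S u -> b v u = 0) -> v = 0.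
  move: v => [v1 v2] [/= Sv1 Sv2] bv.
  have := bv (- v1, v2); rewrite (var_form_sign (v1, v2) (v1, v2)) /= subrr add0r.
  move=> /(_ (conj (fin_dimN fS1 Sv1) Sv2)) /eqP.
  rewrite mulf_eq0 gt_eqF //= -hQ -hW paddr_eq0 ?sqr_ge0 // !sqrf_eq0 !normr_eq0.
  move=> /andP[/eqP C0 /eqP I0]; congr pair.
    apply: nS.1 => // t St; have := bv (0, t) (conj (fin_dim0 fS1) St).
    rewrite /var_form /= C0 I0 (lfun0 (ba.1 _)) (lfun0 (dot_linl _ _)).
    by rewrite (lfun0 (dot_linl _ _)) subrr mulr0 !addr0.
  apply: nS.2 => // t St; have := bv (t, 0) (conj St (fin_dim0 fS2)).
  rewrite /var_form /= C0 I0 (lfun0 (ba.2 _)) (lfun0 (dot_linl _ _)).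
  by rewrite (lfun0 (dot_linl _ _)) subrr mulr0 add0r addr0.
have bC u v : b u v = b v u.
  by rewrite /var_form (dotC ipQ) (dotC ipW) [a u.1 _ + _]addrC.
split; first exact: nondeg.
by move=> v Sv bv; apply: nondeg => // u Su; rewrite bC; exact: bv.
Qed.

Local Notation G := (galerkin b S S).
Local Notation nu := (quasi_best_const (@pair_norm R V1 V2) S G).
Local Notation ritz v := (R1 v.1, R2 v.2).

(** Abstract form of the duality estimates, later supplied with eps = c h^delta. Ritz errors satisfy
    these orthogonality conditions. *)
Variable eps : R.
Hypotheses (eps_ge0 : 0 <= eps)
  (I_small : forall r, (forall t, S2 t -> a r t = 0) -> `|I r| <= eps * `|r|)
  (Cs_small : forall r, (forall s, S1 s -> a s r = 0) -> `|Cs r| <= eps * `|r|).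

Local Notation D := ((1 + mu) * lam * M * eps).

(* With rho = v - ritz v and theta = ritz v - G v, testing the error equation *)
(* with (-theta1, theta2) bounds (C^* e2, I e1) by (C^* rho2, I rho1),        *)
(* uniformly in alpha.                                                        *)
Lemma ritz_galerkin_dist v :
  pair_norm (ritz v - G v) <= D * pair_norm (v - ritz v).
Proof.
have fS := fin_dim_prod fS1 fS2.
have [SG bG] := galerkinP var_form_bilinear fS fS var_form_nondegenerate v.
have [SR1 aR1] := galerkinP ba fS1 fS2 nS v.1.
have [SR2 aR2] := galerkinP ba' fS2 fS1 nS' v.2.
have [mu1 _] := ritz_quasi_best.
have mu0 : 0 <= 1 + mu by rewrite addr_ge0 // (le_trans ler01 mu1).
set th := ritz v - G v; set rho := v - ritz v; pose e := v - G v.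
have eE : e = rho + th by rewrite /e /rho /th addrA subrK.
have Sth1 : S1 th.1 by apply: fin_dimB => //; case: SG.
have Sth2 : S2 th.2 by apply: fin_dimB => //; case: SG.
have be phi : S phi -> b e phi = 0.
  by move=> Sp; rewrite (lfunB (var_form_bilinear.1 _)) bG // subrr.
have rho1 t : S2 t -> a rho.1 t = 0.
  by move=> St; rewrite (lfunB (ba.1 t)) aR1 // subrr.
have rho2 s : S1 s -> a s rho.2 = 0.
  by move=> Ss; rewrite (lfunB (ba.2 s)) aR2 // subrr.
have ae1 t : S2 t -> a e.1 t = a th.1 t.
  by move=> St; rewrite eE (lfunD (ba.1 t)) rho1 // add0r.
have ae2 s : S1 s -> a s e.2 = a s th.2.
  by move=> Ss; rewrite eE (lfunD (ba.2 s)) rho2 // add0r.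
clearbody e th rho.
pose E := Num.sqrt (`|Cs e.2| ^+ 2 + `|I e.1| ^+ 2).
have E_le : E <= eps * pair_norm rho.
  pose E' := Num.sqrt (`|Cs rho.2| ^+ 2 + `|I rho.1| ^+ 2).
  have E'_le : E' <= eps * pair_norm rho.
    rewrite /pair_norm [`|_.1| ^+ 2 + _]addrC -sqrt_sum_sqrM //.
    by apply: ler_sqrt_sum_sqr => //; [exact: Cs_small|exact: I_small].
  apply: le_trans E'_le.
  have [->|E0] := eqVneq E 0; first exact: sqrtr_ge0.
  rewrite -(ler_pM2l (_ : 0 < E)); last by rewrite lt_neqAle eq_sym E0 sqrtr_ge0.
  apply: le_trans (euclid_cauchy_schwarz _ _ _ _).
  rewrite -expr2 sqr_sqrtr ?addr_ge0 ?sqr_ge0 //.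
  have := be (- th.1, th.2) (conj (fin_dimN fS1 Sth1) Sth2).
  rewrite var_form_sign ae1 // ae2 // subrr add0r => /eqP.
  rewrite mulf_eq0 gt_eqF //= => /eqP H.
  have CsD x y : Cs (x + y) = Cs x + Cs y.
    by have := linCs 1 x y; rewrite !scale1r.
  have ID x y : I (x + y) = I x + I y by have := linI 1 x y; rewrite !scale1r.
  have e1E : e.1 = rho.1 + th.1 by rewrite eE.
  have e2E : e.2 = rho.2 + th.2 by rewrite eE.
  (* By [H] the theta part drops out, so E^2 is the pairing of the observations of e with those of
     rho. *)
  rewrite hQ hW [X in ipQ _ (Cs X)]e2E [X in ipW _ (I X)]e1E.
  rewrite (CsD rho.2 th.2) (ID rho.1 th.1).
  rewrite (lfunD (dot_linr ipQ _)) (lfunD (dot_linr ipW _)) addrACA H addr0.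
  by apply: lerD; rewrite (le_trans (ler_norm _)) // dot_le.
have th1_le : `|th.1| <= (1 + mu) * lam * M * `|Cs e.2|.
  (* Fortin's argument: y is the exact partner of theta_1, and its Ritz projection pairs equally
     with the discrete theta_1 while its norm is at most (1 + mu) |theta_1|. *)
  have [y yth ay] := form_attained1 h1 h2 ba a_bounded a_nondeg norm2 th.1.
  have [SRy aRy] := galerkinP ba' fS2 fS1 nS' y.
  have := be (0, R2 y) (conj (fin_dim0 fS1) SRy).
  rewrite /var_form /= ae1 // aRy // ay (lfun0 (ba.1 _)) addr0.
  have -> : I 0 = 0 by have := linI (-1) 0 0; rewrite scaler0 addr0 scaleN1r addNr.
  rewrite (lfun0 (dot_linr _ _)) subr0 => /eqP; rewrite addr_eq0 => /eqP H.
  have [->|nz] := eqVneq th.1 0.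
    by rewrite normr0 !mulr_ge0 // ltW.
  rewrite -(ler_pM2r (_ : 0 < `|th.1|)) ?normr_gt0 // -expr2 H -mulrN.
  rewrite (le_trans (ler_norm _)) // normrM gtr0_norm // normrN.
  rewrite [leRHS](_ : _ = lam * (`|Cs e.2| * (M * ((1 + mu) * `|th.1|)))); last by ring.
  rewrite ler_pM2l // (le_trans (dot_le hQ _ _)) // ler_wpM2l //.
  by rewrite (le_trans (CsM _)) // ler_wpM2l // -yth ritz2_norm.
have th2_le : `|th.2| <= (1 + mu) * lam * M * `|I e.1|.
  have [y yth ay] := form_attained2 h1 h2 ba a_bounded a_nondeg norm2 th.2.
  have [SRy aRy] := galerkinP ba fS1 fS2 nS y.
  have := be (R1 y, 0) (conj SRy (fin_dim0 fS2)).
  rewrite /var_form /= ae2 // aRy // ay (lfun0 (ba.2 _)) add0r.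
  have -> : Cs 0 = 0 by have := linCs (-1) 0 0; rewrite scaler0 addr0 scaleN1r addNr.
  rewrite (lfun0 (dot_linr _ _)) sub0r mulrN => /eqP; rewrite subr_eq0 => /eqP H.
  have [->|nz] := eqVneq th.2 0.
    by rewrite normr0 !mulr_ge0 // ltW.
  rewrite -(ler_pM2r (_ : 0 < `|th.2|)) ?normr_gt0 // -expr2 H.
  rewrite (le_trans (ler_norm _)) // normrM gtr0_norm //.
  rewrite [leRHS](_ : _ = lam * (`|I e.1| * (M * ((1 + mu) * `|th.2|)))); last by ring.
  rewrite ler_pM2l // (le_trans (dot_le hW _ _)) // ler_wpM2l //.
  by rewrite (le_trans (IM _)) // ler_wpM2l // -yth ritz1_norm.
have c0 : 0 <= (1 + mu) * lam * M by rewrite !mulr_ge0 // ltW.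
rewrite -[leRHS]mulrA (le_trans _ (ler_wpM2l c0 E_le)) // -sqrt_sum_sqrM //.
exact: ler_sqrt_sum_sqr.
Qed.

Lemma ritz_pair_le v : pair_norm (v - ritz v) <= mu * best_error (@pair_norm R V1 V2) S v.
Proof.
have [mu1 _] := ritz_quasi_best; have mup : 0 < mu := lt_le_trans ltr01 mu1.
rewrite -ler_pdivrMl //; apply: le_best_error.
  by exists (0, 0); split; exact: fin_dim0.
move=> [w1 w2] [/= Sw1 Sw2]; rewrite ler_pdivrMl // /pair_norm /= -sqrt_sum_sqrM ?(ltW mup) //.
by apply: ler_sqrt_sum_sqr => //; [exact: ritz1_le|exact: ritz2_le].
Qed.

Lemma quasi_best_comparison : 1 <= mu /\ mu * (1 - D) <= nu <= mu * (1 + D).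
Proof.
have [mu1 muP] := ritz_quasi_best.
have mu0 : 0 <= mu by exact: le_trans ler01 mu1.
have D0 : 0 <= D by rewrite !mulr_ge0 ?addr_ge0 // ltW.
have up v : pair_norm (v - G v) <= mu * (1 + D) * best_error (@pair_norm R V1 V2) S v.
  have -> : v - G v = (v - ritz v) + (ritz v - G v) by rewrite addrA subrK.
  rewrite (le_trans (pair_norm_triangle _ _)) //.
  rewrite (le_trans (lerD (lexx _) (ritz_galerkin_dist v))) //.
  rewrite -[X in X + _]mul1r -mulrDl [leRHS]mulrAC mulrC ler_wpM2r ?addr_ge0 //.
  exact: ritz_pair_le.
have up1 : 1 <= mu * (1 + D) by rewrite mulr_ege1 // lerDl.
have [nu1 nuP] : 1 <= nu /\
    forall v, pair_norm (v - G v) <= nu * best_error (@pair_norm R V1 V2) S v.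
  apply: quasi_best_constP; first exact: pair_norm_ge0.
  by exists (mu * (1 + D)).
have nu0 : 0 <= nu by exact: le_trans ler01 nu1.
split => //; apply/andP; split; last exact: quasi_best_const_le.
(* For D >= 1 the lower bound is nonpositive, so no smallness of h is required. *)
have [D1|D1] := ltP D 1; last first.
  by rewrite (le_trans _ nu0) // mulr_ge0_le0 // subr_le0.
have D1' : 0 < 1 - D by rewrite subr_gt0.
rewrite -ler_pdivlMr //; apply: quasi_best_const_le.
  by rewrite ler_pdivlMr // mul1r (le_trans _ nu1) // lerBlDr lerDl.
(* The error of [R1] at u is a component of the Ritz error of (u, 0), and the pairs (w, 0) compete
   in its best approximation; so [nu] controls [mu]. *)
move=> u; pose v : V1 * V2 := (u, 0).
rewrite mulrAC ler_pdivlMr //.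
have u_le : `|u - R1 u| <= pair_norm (v - ritz v).
  rewrite -[leLHS]normr_id -sqrtr_sqr; apply: ler_wsqrtr.
  by rewrite /= lerDl sqr_ge0.
have v_le : best_error (@pair_norm R V1 V2) S v <= best_error (fun v1 : V1 => `|v1|) S1 u.
  apply: le_best_error => [|w Sw]; first by exists 0; exact: fin_dim0.
  have Sw0 : S (w, 0) by split => //; exact: fin_dim0.
  rewrite (le_trans (best_error_le (@pair_norm_ge0 _ _ _) _ Sw0)) //.
  by rewrite /pair_norm /= subr0 normr0 expr0n addr0 sqrtr_sqr normr_id.
apply: le_trans (ler_wpM2l nu0 v_le); apply: le_trans (nuP v).
apply: (@le_trans _ _ (pair_norm (v - ritz v) * (1 - D))).
  by rewrite ler_wpM2r // ltW.
rewrite mulrBr mulr1 lerBlDr.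
have -> : v - ritz v = (v - G v) - (ritz v - G v) by rewrite opprB addrA subrK.
rewrite (le_trans (pair_norm_triangle _ _)) // pair_normN lerD2l.
by rewrite opprB addrA subrK mulrC ritz_galerkin_dist.
Qed.

End comparison.

(** * Duality estimates *)

Section aubin_nitsche.
Context (R : realType) (W V1 V2 : completeNormedModType R)
  (ipW : {dot W for idfun})
  (ip1 : {dot V1 for idfun}) (ip2 : {dot V2 for idfun}).
Hypotheses (hW : hilbert_norm ipW)
  (h1 : hilbert_norm ip1) (h2 : hilbert_norm ip2).
Variable a : V1 -> V2 -> R.
Hypotheses (ba : bilinear_form a) (a_bounded : bounded_form a)
  (a_nondeg : forall v1, (forall v2, a v1 v2 = 0) -> v1 = 0)
  (norm2 : forall v2 : V2,
     `|v2| = sup [set a phi1 v2 | phi1 in [set phi1 : V1 | `|phi1| = 1]]).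
Context (d : nat) (Omega : set 'rV[R]_d).
Hypotheses (oOmega : open Omega) (nested : sobolev_nested Omega).
Variables (delta s1 s2 CS : R).
Hypotheses (delta_gt0 : 0 < delta) (CS_ge1 : 1 <= CS).
Local Notation fnl := ((Rn R d -> R) -> R^o).
Variables (J1 : {linear V1 -> fnl}) (J2 : {linear V2 -> fnl}).
Hypothesis Q1_1 : closed_subspace_of Omega s1 J1 CS.
Variable CR : R.
Hypotheses (CR_gt0 : 0 < CR)
  (Q3_A : forall f, Hs Omega (- s2 + delta) f ->
     let v1 := inv_op a (restr Omega s2 J2 f) in
     Hs_in Omega s1 (s1 + delta) (J1 v1) /\
     Hs_norm_in Omega s1 (s1 + delta) (J1 v1) <=
       CR * Hs_norm Omega (- s2 + delta) f)
  (Q3_As : forall g, Hs Omega (- s1 + delta) g ->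
     let v2 := inv_op (fun v2 => a^~ v2) (restr Omega s1 J1 g) in
     Hs_in Omega s2 (s2 + delta) (J2 v2) /\
     Hs_norm_in Omega s2 (s2 + delta) (J2 v2) <=
       CR * Hs_norm Omega (- s1 + delta) g).
Variables (S1 : set V1) (S2 : set V2) (eta : R).
Hypotheses (fS1 : fin_dim_subspace S1) (fS2 : fin_dim_subspace S2)
  (eta_ge0 : 0 <= eta)
  (Q4 : forall v : V1 * V2,
     Hs_in Omega s1 (s1 + delta) (J1 v.1) ->
     Hs_in Omega s2 (s2 + delta) (J2 v.2) ->
     best_error (@pair_norm R V1 V2) (S1 `*` S2) v <=
       eta *
       Num.sqrt (Hs_norm_in Omega s1 (s1 + delta) (J1 v.1) ^+ 2 +
                 Hs_norm_in Omega s2 (s2 + delta) (J2 v.2) ^+ 2)).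

(** Orthogonality allows any discrete w1 to be subtracted from z, and [Q4] for the pair (z, 0)
    bounds the distance. *)
Lemma dual_approx1 z r : Hs_in Omega s1 (s1 + delta) (J1 z) ->
  (forall s, S1 s -> a s r = 0) ->
  `|a z r| <= `|r| * (eta * Hs_norm_in Omega s1 (s1 + delta) (J1 z)).
Proof.
move=> Hz ar; have [H0 n0] := Hs_in_zero oOmega nested s2 (s2 + delta).
rewrite -(linear0 J2) in H0 n0.
have := @Q4 (z, 0) Hz H0; rewrite /= n0 expr0n addr0 sqrtr_sqr ger0_norm ?Hs_norm_in_ge0 //.
move=> best; apply: le_trans (ler_wpM2l (normr_ge0 r) best).
apply: le_best_errorM => //; first by exists (0, 0); split; exact: fin_dim0.
move=> [w1 w2] [/= Sw1 _].
have -> : a z r = a (z - w1) r by rewrite (lfunB (ba.1 r)) (ar w1) // subr0.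
rewrite (le_trans (form_le h1 h2 ba a_bounded a_nondeg norm2 _ _)) // mulrC ler_wpM2l //.
rewrite -[leLHS]normr_id -sqrtr_sqr; apply: ler_wsqrtr.
by rewrite /= lerDl sqr_ge0.
Qed.

Lemma dual_approx2 z r : Hs_in Omega s2 (s2 + delta) (J2 z) ->
  (forall t, S2 t -> a r t = 0) ->
  `|a r z| <= `|r| * (eta * Hs_norm_in Omega s2 (s2 + delta) (J2 z)).
Proof.
move=> Hz ar; have [H0 n0] := Hs_in_zero oOmega nested s1 (s1 + delta).
rewrite -(linear0 J1) in H0 n0.
have := @Q4 (0, z) H0 Hz; rewrite /= n0 expr0n add0r sqrtr_sqr ger0_norm ?Hs_norm_in_ge0 //.
move=> best; apply: le_trans (ler_wpM2l (normr_ge0 r) best).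
apply: le_best_errorM => //; first by exists (0, 0); split; exact: fin_dim0.
move=> [w1 w2] [/= _ Sw2].
have -> : a r z = a r (z - w2) by rewrite (lfunB (ba.2 r)) (ar w2) // subr0.
rewrite (le_trans (form_le h1 h2 ba a_bounded a_nondeg norm2 _ _)) // ler_wpM2l //.
rewrite -[leLHS]normr_id -sqrtr_sqr; apply: ler_wsqrtr.
by rewrite /= lerDr sqr_ge0.
Qed.

(** With z solving A z = f, the value of f at r is a(z, r), and the extra regularity of z is
    converted into the factor [eta]. *)
Lemma restr_small1 f r : Hs Omega (- s2 + delta) f ->
  linear_functional (restr Omega s2 J2 f) ->
  (exists K, forall v, `|restr Omega s2 J2 f v| <= K * `|v|) ->
  (forall s, S1 s -> a s r = 0) ->
  `|restr Omega s2 J2 f r| <= eta * CR * Hs_norm Omega (- s2 + delta) f * `|r|.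
Proof.
move=> Hf lf bf ar; have [Hz nz] := Q3_A Hf.
have <- := inv_op_form1 h1 h2 ba a_bounded a_nondeg norm2 lf bf.
rewrite (le_trans (dual_approx1 Hz ar)) // [leRHS]mulrC ler_wpM2l //.
by rewrite -mulrA ler_wpM2l.
Qed.

Lemma restr_small2 g r : Hs Omega (- s1 + delta) g ->
  linear_functional (restr Omega s1 J1 g) ->
  (exists K, forall v, `|restr Omega s1 J1 g v| <= K * `|v|) ->
  (forall t, S2 t -> a r t = 0) ->
  `|restr Omega s1 J1 g r| <= eta * CR * Hs_norm Omega (- s1 + delta) g * `|r|.
Proof.
move=> Hg lg bg ar; have [Hz nz] := Q3_As Hg.
have /(congr1 (fun F => F r)) <- := inv_op_form2 h1 h2 ba a_bounded a_nondeg norm2 lg bg.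
rewrite (le_trans (dual_approx2 Hz ar)) // [leRHS]mulrC ler_wpM2l //.
by rewrite -mulrA ler_wpM2l.
Qed.

Let Hs_J1 v : Hs Omega s1 (J1 v). Proof. by case: Q1_1. Qed.

Let Hs_norm_J1 v : Hs_norm Omega s1 (J1 v) <= CS * `|v|.
Proof.
have CS0 : 0 < CS by exact: lt_le_trans ltr01 CS_ge1.
by case: Q1_1 => _ _ /(_ v) /andP[+ _]; rewrite ler_pdivrMl.
Qed.

(* For s1 <= delta, functions u in H^(delta - s1) serve as test functionals   *)
(* through the pivot.                                                         *)
Lemma eval_small u r : s1 <= delta -> HF Omega (- s1 + delta) u ->
  (forall t, S2 t -> a r t = 0) ->
  `|J1 r u| <= eta * CR * HF_norm Omega (- s1 + delta) u * `|r|.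
Proof.
move=> s1d Hu ar; have t0 : 0 <= - s1 + delta by rewrite addrC subr_ge0.
have st : - s1 <= - s1 + delta by rewrite lerDl ltW.
have Hp : Hs Omega (- s1 + delta) (pivot Omega u) by exact: (HsP t0 Hu).
have restrE v : restr Omega s1 J1 (pivot Omega u) v = J1 v u.
  exact: (Hs_pair_pivot oOmega nested t0 st).
rewrite -restrE -(Hs_norm_pivot oOmega nested t0 Hu (fun phi _ => erefl)).
apply: restr_small2 => //.
  by move=> c v w; rewrite !restrE linearP.
have [|K KJ] := Hs_eval_bounded oOmega nested (s := s1) (u := u).
  have m0 : 0 <= Num.max 0 (- s1) by rewrite le_max lexx.
  have mt : Num.max 0 (- s1) <= - s1 + delta by rewrite ge_max t0.
  by have [K _ /(_ u Hu)[]] := HF_nested nested m0 mt.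
exists (`|K| * CS) => v; rewrite restrE (le_trans (KJ _ (Hs_J1 v))) //.
by rewrite -mulrA (le_trans (ler_wpM2r (Hs_norm_ge0 _ _ _) (ler_norm K))) // ler_wpM2l.
Qed.

(** For s1 < delta this is a dual norm, a supremum of values covered by [eval_small]; for s1 = delta
    it is the L^2 norm of a function, which is tested with itself. *)
Lemma Hs_norm_small r : s1 <= delta -> (forall t, S2 t -> a r t = 0) ->
  Hs_norm Omega (s1 - delta) (J1 r) <= eta * CR * `|r|.
Proof.
move=> s1d ar; have sE : - (s1 - delta) = - s1 + delta by rewrite opprB addrC.
have cr0 : 0 <= eta * CR * `|r| by rewrite !mulr_ge0 // ltW.
have [sd|] := eqVneq (s1 - delta) 0.
  have s1E : - s1 + delta = 0 by rewrite -sE sd oppr0.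
  have Hr : Hs Omega 0 (J1 r).
    by apply: (Hs_incl oOmega nested _ (Hs_J1 r)); rewrite -sd gerBl ltW.
  have [Hu fu] := Hs_funP (lexx 0) Hr.
  set u := Hs_fun _ _ _ in Hu fu; have Lu := (HF0P Omega u).1 Hu.
  rewrite sd (Hs_norm_pivot oOmega nested (lexx 0) Hu fu).
  have [->//|N0] := eqVneq (HF_norm Omega 0 u) 0.
  have Np : 0 < HF_norm Omega 0 u by rewrite lt_neqAle eq_sym N0 HF_norm_ge0.
  have NE : HF_norm Omega 0 u ^+ 2 = J1 r u.
    rewrite fu // (HF_norm0 Lu) sqr_sqrtr //.
    by apply: Rintegral_ge0 => x _; rewrite -expr2 sqr_ge0.
  rewrite -(ler_pM2r Np) -expr2 NE (le_trans (ler_norm _)) // mulrAC.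
  by have := @eval_small u r s1d; rewrite s1E; exact.
move=> sd0; have sd : s1 - delta < 0 by rewrite lt_neqAle sd0 subr_le0.
rewrite /Hs_norm [0 <= _]leNgt sd /= sE; apply: ge_sup.
  have [Hz nz] := HF_zero oOmega (- s1 + delta).
  by exists `|J1 r (fun=> 0)|, (fun=> 0) => //=; rewrite nz ler01.
move=> _ [u [Hu nu] <-]; rewrite (le_trans (eval_small s1d Hu ar)) // ler_wpM2r //.
by rewrite ler_piMr // mulr_ge0 // ltW.
Qed.

Variables (I : {linear V1 -> W}) (It : fnl -> W) (KI : R).
Hypotheses (I_bounded : bounded_op I)
  (It_lin : forall c f g, Hs Omega (s1 - delta) f -> Hs Omega (s1 - delta) g ->
     It (c *: f + g) = c *: It f + It g)
  (It_bounded : forall f, Hs Omega (s1 - delta) f ->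
     `|It f| <= KI * Hs_norm Omega (s1 - delta) f)
  (ItJ : forall v1, It (J1 v1) = I v1).

(* For s1 > delta, f |-> (It f, w)_W is an element of H^(delta - s1).  The    *)
(* pivot is cut off outside L^2, where its values are junk, so that it        *)
(* becomes linear in the function.                                            *)
Lemma observation_functional w : delta < s1 -> exists g,
  [/\ Hs Omega (- s1 + delta) g,
      Hs_norm Omega (- s1 + delta) g <= `|KI| * `|w| &
      forall v, restr Omega s1 J1 g v = ipW (I v) w].
Proof.
move=> s1d; have [lin bounded] := (It_lin, It_bounded); set tau := s1 - delta in lin bounded *.
have sE : - (- s1 + delta) = tau by rewrite opprD opprK.
have tau0 : 0 <= tau by rewrite subr_ge0 ltW.
have neg : - s1 + delta < 0 by rewrite addrC subr_lt0.
pose pv (u : Rn R d -> R) : fnl :=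
  fun phi => if `[< HF Omega 0 phi >] then pivot Omega u phi else 0.
have pvE u phi : HF Omega 0 phi -> pv u phi = pivot Omega u phi.
  by move=> Hp; rewrite /pv asboolT.
have pvH u : HF Omega tau u -> Hs Omega tau (pv u).
  by move=> Hu; apply: (HsP tau0 Hu); exact: pvE.
have L2H u : HF Omega tau u -> HF Omega 0 u.
  by move=> Hu; apply/HF0P/(HF_L2 nested tau0 Hu).
have pv_lin c u v : HF Omega tau u -> HF Omega tau v -> pv (c *: u + v) = c *: pv u + pv v.
  move=> /L2H/HF0P Lu /L2H/HF0P Lv; apply/funext => phi.
  rewrite -[RHS]/(c * pv u phi + pv v phi) /pv; case: asboolP => [/HF0P Lp|_].
    exact: (pivot_lin oOmega).
  by rewrite mulr0 addr0.
pose g u := ipW (It (pv u)) w.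
have g_le u : HF Omega tau u -> `|g u| <= `|KI| * `|w| * HF_norm Omega tau u.
  move=> Hu; rewrite (le_trans (dot_le hW _ _)) // mulrAC ler_wpM2r //.
  rewrite (le_trans (bounded _ (pvH u Hu))) //.
  rewrite (Hs_norm_pivot oOmega nested tau0 Hu (pvE u)).
  by rewrite ler_wpM2r ?HF_norm_ge0 // ler_norm.
exists g; split.
- rewrite /Hs /= leNgt neg /= sE; split; last by exists (`|KI| * `|w|).
  move=> c u v Hu Hv; rewrite /g pv_lin // lin; try exact: pvH.
  exact: (dot_linl ipW w).
- rewrite /Hs_norm [0 <= _]leNgt neg /= sE; apply: ge_sup.
    have [Hz nz] := HF_zero oOmega tau.
    by exists `|g (fun=> 0)|, (fun=> 0) => //=; rewrite nz ler01.
  move=> _ [u [Hu nu] <-]; rewrite (le_trans (g_le u Hu)) //.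
  by rewrite ler_piMr // mulr_ge0.
move=> v; have s10 : 0 <= s1 by rewrite (le_trans _ (ltW s1d)) // ltW.
have tau1 : tau <= s1 by rewrite gerBl ltW.
rewrite /restr /Hs_pair s10 /g -ItJ; congr (ipW _ w).
have [Hu fu] := Hs_funP s10 (Hs_J1 v); set u := Hs_fun _ _ _ in Hu fu *.
have [K _ /(_ u Hu)[Hu' _]] := HF_nested nested tau0 tau1.
have HJ : Hs Omega tau (J1 v) by exact: (Hs_incl oOmega nested tau1).
have [Hz nz] := HF_zero oOmega tau.
(* [J1 v] and [pv u] represent the same element but may differ as functionals. Their difference has
   norm 0, so boundedness and linearity make [It] identify them. *)
have dE phi : HF Omega 0 phi -> (-1 *: pv u + J1 v) phi = pivot Omega (fun=> 0) phi.
  move=> Hp; rewrite -[LHS]/(-1 * pv u phi + J1 v phi) pvE // fu // mulN1r addNr.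
  by rewrite (pivot_zero oOmega).
have := bounded _ (HsP tau0 Hz dE).
rewrite (Hs_norm_pivot oOmega nested tau0 Hz dE) nz mulr0 normr_le0.
rewrite lin //; last exact: pvH.
by rewrite scaleN1r addrC subr_eq0 eq_sym => /eqP.
Qed.

(** For s1 <= delta the norm of [J1 r] in H^(s1 - delta) is itself small. For s1 > delta the
    functional built from w = [I r] takes the value |I r|^2 at r, and one factor cancels after
    duality. *)
Lemma observation_small r : (forall t, S2 t -> a r t = 0) ->
  `|I r| <= `|KI| * CR * eta * `|r|.
Proof.
move=> ar; have [s1d|s1d] := leP s1 delta.
  have HJ : Hs Omega (s1 - delta) (J1 r).
    by apply: (Hs_incl oOmega nested _ (Hs_J1 r)); rewrite gerBl ltW.
  rewrite -ItJ (le_trans (It_bounded HJ)) // (le_trans (ler_norm _)) //.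
  rewrite normrM [`|Hs_norm _ _ _|]ger0_norm ?Hs_norm_ge0 // -!mulrA ler_wpM2l //.
  by rewrite mulrCA mulrA Hs_norm_small.
have [g [Hg ng gE]] := observation_functional (I r) s1d.
have gE' : restr Omega s1 J1 g = (fun v => ipW (I v) (I r)) by exact/funext.
have := restr_small2 Hg _ _ ar; rewrite gE' -hW ger0_norm ?sqr_ge0 // => small.
have [->|Ir0] := eqVneq (I r) 0; first by rewrite normr0 !mulr_ge0 // ltW.
rewrite -(ler_pM2r (_ : 0 < `|I r|)) ?normr_gt0 // -expr2.
apply: le_trans (small _ _) _.
- by move=> c v w; rewrite linearP; exact: (dot_linl ipW (I r)).
- have [K IK] := I_bounded; exists (K * `|I r|) => v.
  by rewrite (le_trans (dot_le hW _ _)) // mulrAC ler_wpM2r.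
rewrite [leRHS](_ : _ = eta * CR * (`|KI| * `|I r|) * `|r|); last by ring.
by rewrite ler_wpM2r // ler_wpM2l // mulr_ge0 // ltW.
Qed.

End aubin_nitsche.

(** * Assembly of the estimates and their constants *)

Lemma bilinear_form_of (R : realType) (U V : lmodType R)
    (B : {bilinear U -> V -> R | *%R & *%R}) : bilinear_form (B : U -> V -> R).
Proof. by split=> [v c x y|u c x y]; rewrite ?linearPl ?linearPr. Qed.

Lemma adjoint_linear (R : realType) (Q V : completeNormedModType R)
    (ip : {dot Q for idfun}) (C : Q -> V -> R) (Cs : V -> Q) :
  hilbert_norm ip -> bilinear_form C -> (forall q v, ip q (Cs v) = C q v) ->
  linear Cs.
Proof.
move=> hQ bC adj c x y; apply/eqP; rewrite -subr_eq0 -normr_eq0 -sqrf_eq0 hQ.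
set z := Cs (c *: x + y) - _.
rewrite {2}/z (lfunB (dot_linr _ _)) dot_linr !adj (bC.2 z) subrr //.
Qed.

(* With M = 0 both sides of the last inequality vanish, also thanks to        *)
(* x / 0 = 0.                                                                 *)
Lemma kappa_bar_ge (R : realType) (M mubar alpha c : R) :
  0 <= M -> 1 <= mubar -> 0 < alpha -> 0 <= c ->
  0 < kappa_bar M mubar alpha /\
  (Num.sqrt alpha)^-1 * M * c <= kappa_bar M mubar alpha * (c / (2 * M)).
Proof.
move=> M0 mu1 al0 c0; rewrite /kappa_bar /=; set lam := (Num.sqrt alpha)^-1.
have lam0 : 0 <= lam by rewrite invr_ge0 sqrtr_ge0.
have Ml0 : 0 <= M * lam by exact: mulr_ge0.
set X := 1 + M * (1 + 2 * M * lam) * mubar.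
have XE : 1 + 2 * M * (M * lam) <= X.
  have : M * (1 + 2 * M * lam) <= M * (1 + 2 * M * lam) * mubar.
    by rewrite ler_peMr // mulr_ge0 // addr_ge0 // -mulrA mulr_ge0.
  by rewrite /X; nra.
have X0 : 0 < X by apply: lt_le_trans XE; rewrite ltr_wpDr // !mulr_ge0.
set F := (1 + 2 * (M * lam)) / (1 + M * lam).
have F1 : 1 <= F by rewrite ler_pdivlMr ?ltr_wpDr // mul1r; lra.
have FX : X <= F * X by rewrite ler_peMl // ltW.
split; first exact: lt_le_trans X0 FX.
have [->|Mn0] := eqVneq M 0; first by rewrite !mulr0 mul0r invr0 !mulr0.
have Mp : 0 < M by rewrite lt_neqAle eq_sym Mn0.
(* The summand 2 M^2 alpha^(-1/2) absorbs alpha^(-1/2) M at the price of the factor c / (2 M), free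
   of alpha. *)
have -> : lam * M * c = (2 * M * (M * lam)) * (c / (2 * M)) by field.
apply: ler_wpM2r; first by rewrite divr_ge0 // mulr_ge0.
by apply: le_trans FX; apply: le_trans XE; rewrite lerDr.
Qed.

Theorem theorem3p7 (R : realType)
  (Q W V1 V2 : completeNormedModType R)
  (ipQ : {dot Q for idfun}) (ipW : {dot W for idfun})
  (ip1 : {dot V1 for idfun}) (ip2 : {dot V2 for idfun})
  (hQ : hilbert_norm ipQ) (hW : hilbert_norm ipW)
  (h1 : hilbert_norm ip1) (h2 : hilbert_norm ip2)
  (a : {bilinear V1 -> V2 -> R | *%R & *%R})
  (a_bounded : bounded_form a)
  (a_nondeg : forall v1, (forall v2, a v1 v2 = 0) -> v1 = 0)
  (a_infsup : (0 < ereal_inf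
     [set ereal_sup [set (a v1 v2)%:E | v1 in [set v1 : V1 | (`|v1| = 1)%R]]
     | v2 in [set v2 : V2 | (`|v2| = 1)%R]])%E)
  (norm2 : forall v2 : V2,
     `|v2| = sup [set a phi1 v2 | phi1 in [set phi1 : V1 | `|phi1| = 1]])
  (C : {bilinear Q -> V2 -> R | *%R & *%R}) (C_bounded : bounded_form C)
  (Cs : V2 -> Q) (Cs_adj : forall q v2, ipQ q (Cs v2) = C q v2)
  (I : {linear V1 -> W}) (I_bounded : bounded_op I)
  (h : nat -> R) (h_gt0 : forall k, 0 < h k)
  (h_cvg0 : h k @[k --> \oo] --> (0 : R))
  (Vh1 : nat -> set V1) (Vh2 : nat -> set V2)
  (Vh1_fin : forall k, fin_dim_subspace (Vh1 k))
  (Vh2_fin : forall k, fin_dim_subspace (Vh2 k))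
  (Vh_nondeg : forall k, nondegenerate_on a (Vh1 k) (Vh2 k))
  (d : nat) (d_gt0 : (0 < d)%N) (Omega : set 'rV[R]_d)
  (Omega_domain : is_domain Omega) (Omega_nested : sobolev_nested Omega)
  (delta : R) (delta_gt0 : 0 < delta)
  (s1 s2 CS : R) (CS_ge1 : 1 <= CS)
  (J1 : {linear V1 -> ((Rn R d -> R) -> R^o)})
  (J2 : {linear V2 -> ((Rn R d -> R) -> R^o)})
  (Q1_1 : closed_subspace_of Omega s1 J1 CS)
  (Q1_2 : closed_subspace_of Omega s2 J2 CS)
  (Q2_C : exists Ct : {linear Q -> ((Rn R d -> R) -> R^o)},
     (forall q, Hs Omega (- s2 + delta) (Ct q) /\
        restr Omega s2 J2 (Ct q) = C q) /\
     exists K, forall q, Hs_norm Omega (- s2 + delta) (Ct q) <= K * `|q|)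
  (Q2_I : exists It : ((Rn R d -> R) -> R^o) -> W,
     [/\ forall c f g, Hs Omega (s1 - delta) f -> Hs Omega (s1 - delta) g ->
           It (c *: f + g) = c *: It f + It g,
         exists K, forall f, Hs Omega (s1 - delta) f ->
           `|It f| <= K * Hs_norm Omega (s1 - delta) f &
         forall v1, It (J1 v1) = I v1])
  (CR : R) (CR_gt0 : 0 < CR)
  (Q3_A : forall f, Hs Omega (- s2 + delta) f ->
     let v1 := inv_op (fun v1 => a v1 : V2 -> R) (restr Omega s2 J2 f) in
     Hs_in Omega s1 (s1 + delta) (J1 v1) /\
     Hs_norm_in Omega s1 (s1 + delta) (J1 v1) <=
       CR * Hs_norm Omega (- s2 + delta) f)
  (Q3_As : forall g, Hs Omega (- s1 + delta) g ->
     let v2 := inv_op (fun v2 => a^~ v2 : V1 -> R) (restr Omega s1 J1 g) in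
     Hs_in Omega s2 (s2 + delta) (J2 v2) /\
     Hs_norm_in Omega s2 (s2 + delta) (J2 v2) <=
       CR * Hs_norm Omega (- s1 + delta) g)
  (CI : R) (CI_gt0 : 0 < CI)
  (Q4 : forall k (v : V1 * V2),
     Hs_in Omega s1 (s1 + delta) (J1 v.1) ->
     Hs_in Omega s2 (s2 + delta) (J2 v.2) ->
     best_error (@pair_norm R V1 V2) (Vh1 k `*` Vh2 k) v <=
       CI * h k `^ delta *
       Num.sqrt (Hs_norm_in Omega s1 (s1 + delta) (J1 v.1) ^+ 2 +
                 Hs_norm_in Omega s2 (s2 + delta) (J2 v.2) ^+ 2)) :
  let mu k := quasi_best_const (fun v1 : V1 => `|v1|) (Vh1 k)
    (galerkin a (Vh1 k) (Vh2 k)) in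
  let Vh k := Vh1 k `*` Vh2 k in
  let b alpha := var_form a Cs I ipQ ipW alpha in
  let nu alpha k := quasi_best_const (@pair_norm R V1 V2) (Vh k)
    (galerkin (b alpha) (Vh k) (Vh k)) in
  let M := Num.max (op_norm I) (form_norm C) in
  forall mubar, 1 <= mubar -> (forall k, mu k <= mubar) ->
  exists c : R, \forall k \near \oo, forall alpha, 0 < alpha ->
    exists r : R, `|r| <= c * h k `^ delta /\
      nu alpha k = mu k * (1 + kappa_bar M mubar alpha * r).
Proof.
move=> mu Vh b nu M mubar mubar1 mu_le.
have oO : open Omega by case: Omega_domain.
have ba := bilinear_form_of a; have bC := bilinear_form_of C.
have linCs : linear Cs by exact: adjoint_linear hQ bC Cs_adj.
have M_I : op_norm I <= M by rewrite le_max lexx.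
have M_C : form_norm C <= M by rewrite le_max lexx orbT.
have M0 : 0 <= M by apply: le_trans M_I; apply: sup_ge0 => _ [v _ <-].
have IM v : `|I v| <= M * `|v|.
  by rewrite (le_trans (le_op_norm I_bounded v)) // ler_wpM2r.
have CsM v : `|Cs v| <= M * `|v|.
  have [->|nz] := eqVneq (Cs v) 0; first by rewrite normr0 mulr_ge0.
  rewrite -(ler_pM2r (_ : 0 < `|Cs v|)) ?normr_gt0 // -expr2 hQ Cs_adj.
  rewrite (le_trans (ler_norm _)) // (le_trans (le_form_norm bC C_bounded _ _)) //.
  by rewrite mulrAC ler_wpM2r // ler_wpM2r.
have [Ct [CtP [KC CtK]]] := Q2_C; have [It [It_lin [KI It_K] ItJ]] := Q2_I.
(* The two operator bounds are added so that one constant, free of h and alpha, serves both duality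
   estimates. *)
pose c := (`|KI| + `|KC|) * CR * CI.
have c0 : 0 <= c by rewrite !mulr_ge0 ?addr_ge0 // ltW.
(* The divisor 2 M comes from [kappa_bar_ge]; for M = 0 the witness is 0, as is the relative
   distance of the two projections. The estimate holds for every k. *)
exists ((1 + mubar) * c / (2 * M)); apply: nearW => k alpha alpha_gt0.
have hk0 : 0 <= h k `^ delta by exact: powR_ge0.
have eta0 : 0 <= CI * h k `^ delta by rewrite mulr_ge0 // ltW.
have I_small r : (forall t, Vh2 k t -> a r t = 0) -> `|I r| <= c * h k `^ delta * `|r|.
  move=> ar; have := @observation_small R W V1 V2 ipW ip1 ip2 hW h1 h2 a ba a_bounded
    a_nondeg norm2 d Omega oO Omega_nested delta s1 s2 CS delta_gt0 CS_ge1 J1 J2 Q1_1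
    CR CR_gt0 Q3_As (Vh1 k) (Vh2 k) _ (Vh1_fin k) (Vh2_fin k) eta0 (Q4 k) I It KI
    I_bounded It_lin It_K ItJ r ar.
  move=> /le_trans; apply; rewrite ler_wpM2r // /c -!mulrA ler_wpM2r ?lerDl //.
  by rewrite !mulr_ge0 // ltW.
have Cs_small r : (forall s, Vh1 k s -> a s r = 0) -> `|Cs r| <= c * h k `^ delta * `|r|.
  (* The data of the dual problem is C applied to [Cs r]; by adjointness its value at r is |Cs
     r|^2. *)
  move=> ar; have [Hf fC] := CtP (Cs r).
  have := @restr_small1 R V1 V2 ip1 ip2 h1 h2 a ba a_bounded
    a_nondeg norm2 d Omega oO Omega_nested delta s1 s2 J1 J2 
    CR Q3_A (Vh1 k) (Vh2 k) _ (Vh1_fin k) (Vh2_fin k) eta0 (Q4 k) (Ct (Cs r)) r Hf.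
  rewrite fC => /(_ (bC.2 _) _ ar).
  rewrite -Cs_adj -hQ ger0_norm ?sqr_ge0 // => small.
  have [->|nz] := eqVneq (Cs r) 0; first by rewrite normr0 mulr_ge0 // mulr_ge0.
  rewrite -(ler_pM2r (_ : 0 < `|Cs r|)) ?normr_gt0 // -expr2.
  apply: le_trans (small _) _.
    by have [K CK] := C_bounded; exists (K * `|Cs r|) => v; exact: CK.
  have nle : Hs_norm Omega (- s2 + delta) (Ct (Cs r)) <= (`|KI| + `|KC|) * `|Cs r|.
    rewrite (le_trans (CtK _)) // ler_wpM2r // (le_trans (ler_norm _)) //.
    by rewrite lerDr.
  rewrite [leRHS](_ : _ = CI * h k `^ delta * CR * ((`|KI| + `|KC|) * `|Cs r|) * `|r|).
    by rewrite ler_wpM2r // ler_wpM2l // mulr_ge0 // ltW.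
  rewrite /c; ring.
clearbody c.
have [mu1 /andP[low up]] := @quasi_best_comparison R Q W V1 V2 ipQ ipW ip1 ip2 hQ hW h1 h2
  a ba a_bounded a_nondeg norm2 Cs I M linCs (linearP I) CsM IM M0 (Vh1 k) (Vh2 k)
  (Vh1_fin k) (Vh2_fin k) (Vh_nondeg k) alpha alpha_gt0 (c * h k `^ delta)
  (mulr_ge0 c0 hk0) I_small Cs_small.
rewrite -/(mu k) -/(nu alpha k) in mu1 low up.
have muk0 : 0 < mu k by exact: lt_le_trans ltr01 mu1.
have C0 : 0 <= (1 + mubar) * c * h k `^ delta.
  by rewrite mulr_ge0 // mulr_ge0 // addr_ge0 // (le_trans ler01).
have [kap0 kapP] := kappa_bar_ge M0 mubar1 alpha_gt0 C0.
set kap := kappa_bar _ _ _ in kap0 kapP *.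
(* The asserted identity solved for [r]; only the size of [r] then remains to be bounded. *)
exists ((nu alpha k / mu k - 1) / kap); split; last first.
  by rewrite [kap * _]mulrC divfK ?gt_eqF // addrC subrK mulrC divfK // gt_eqF.
rewrite normrM normfV (gtr0_norm kap0) ler_pdivrMr //.
set D := (1 + mu k) * _ * M * _ in low up.
have D_le : D <= (Num.sqrt alpha)^-1 * M * ((1 + mubar) * c * h k `^ delta).
  rewrite /D [leRHS](_ : _ = (1 + mubar) *
    ((Num.sqrt alpha)^-1 * M * (c * h k `^ delta))); last by ring.
  rewrite -!mulrA ler_wpM2r ?lerD2l //.
  apply: mulr_ge0; first by rewrite invr_ge0 sqrtr_ge0.
  by rewrite mulr_ge0 // mulr_ge0.
rewrite [leRHS](_ : _ = kap * ((1 + mubar) * c * h k `^ delta / (2 * M))); last by ring.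
apply: le_trans (le_trans D_le kapP).
rewrite ler_norml; apply/andP; split.
  by rewrite lerBrDr addrC ler_pdivlMr // mulrC.
by rewrite lerBlDr addrC ler_pdivrMr // mulrC.
Qed.
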